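(* The function defined on $(0,+\infty)\times(0,+\infty)$ by $$(t,x)\longmapsto f_{\tau_x}(t,x)=\lambda\,\mathbb{E}\left(\mathbf 1_{\{\tau_x>t\}}(1-F_Y)(x-X_t)\right)+\mathbb{E}\left(\mathbf 1_{\{\tau_x>T_{N_t}\}}\tilde f(t-T_{N_t},x-X_{T_{N_t}})\right)$$ is continuous.
   Context: On a probability space $(\Omega,\mathcal F,\mathbb P)$ let $X_t=mt+W_t+\sum_{i=1}^{N_t}Y_i$, $t\ge 0$, where $m\in\mathbb{R}$, $W$ is a standard Brownian motion, $N$ is a Poisson process with constant intensity $\lambda>0$, and $(Y_i)_{i\ge1}$ are i.i.d. real random variables with distribution function $F_Y(y)=\mathbb{P}(Y_1\le y)$; $W$, $N$ and $(Y_i)_{i\ge 1}$ are independent. Let $(T_n)_{n\ge1}$ be the successive jump times of $N$ and $T_0=0$, so $T_{N_t}$ is the last jump time of $N$ in $[0,t]$ (or $0$ if there is none). For $x>0$, $\tau_x=\inf\{t\ge0: X_t\ge x\}$. For $u>0$ and $z\in\mathbb{R}$, $\tilde f(u,z)=\frac{|z|}{\sqrt{2\pi u^3}}\exp\left[-\frac{(z-mu)^2}{2u}\right]$, and $\tilde f(u,z)=0$ for $u\le0$. $(1-F_Y)(y)$ means $1-F_Y(y)$. *)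

(* Defs.v *)
From HB Require Import structures.
From mathcomp Require Import all_boot all_order all_algebra finmap.
From mathcomp Require Import all_classical all_reals all_analysis.

Set Implicit Arguments.
Unset Strict Implicit.
Unset Printing Implicit Defensive.

Import Order.TTheory GRing.Theory Num.Theory.
Import numFieldNormedType.Exports.

Local Open Scope classical_set_scope.
Local Open Scope ring_scope.

Section independence.
Context {R : realType} {d : measure_display} {Omega : measurableType d}.
Variable P : probability Omega R.

(* Mutual independence of a family of sigma-algebras (given as sets of events):
   the product rule on every finite subfamily. *)
Definition mutually_independent (I : choiceType)
    (F : I -> set (set Omega)) : Prop :=
  forall (J : {fset I}) (A : I -> set Omega),
    (forall i, i \in J -> F i (A i)) ->
    P (\bigcap_(i in [set` J]) A i) = (\prod_(i <- J) P (A i))%E.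

Definition sigma_rv {d' : measure_display} {E : measurableType d'}
    (X : Omega -> E) : set (set Omega) :=
  preimage_set_system setT X measurable.

Definition sigma_family {d' : measure_display} {E : measurableType d'}
    (I : Type) (D : set I) (X : I -> Omega -> E) : set (set Omega) :=
  <<s \bigcup_(i in D) sigma_rv (X i) >>.

(* Monotone infinite sequences of times encode the finite ones, a finite
   sequence being continued by a constant. *)
Definition independent_increments (X : R -> Omega -> R) : Prop :=
  forall t : nat -> R, 0 <= t 0%N -> (forall i, t i <= t i.+1) ->
    mutually_independent
      (fun i => sigma_rv (fun w => X (t i.+1) w - X (t i) w)).

Definition iid (Y : nat -> {RV P >-> R}) : Prop :=
  mutually_independent (fun i => sigma_rv (Y i)) /\
  (forall i (A : set R), measurable A ->
    distribution P (Y i) A = distribution P (Y 0%N) A).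

End independence.

Section processes.
Context {R : realType} {d : measure_display} {Omega : measurableType d}.
Variable P : probability Omega R.

(* Processes are indexed by R, and only their values at times t >= 0 matter. *)

(* [normal_prob] is parametrized by the standard deviation. *)
Definition brownian_motion (W : R -> {RV P >-> R}) : Prop :=
  [/\ {ae P, forall w, W 0 w = 0},
      {ae P, forall w, {within `[0, +oo[, continuous (fun t : R => W t w)}},
      independent_increments P (fun t w => W t w) &
      forall s t : R, 0 <= s -> s < t -> forall A : set R, measurable A ->
        P [set w | A (W t w - W s w)] = normal_prob 0 (Num.sqrt (t - s)) A].

Definition poisson_process (lambda : R) (N : R -> {RV P >-> nat}) : Prop :=
  [/\ {ae P, forall w, N 0 w = 0%N},
      {ae P, forall w,
        (forall s t : R, 0 <= s -> s <= t -> (N s w <= N t w)%N) /\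
        (forall t : R, 0 <= t -> N s w @[s --> t^'+] --> N t w)},
      independent_increments P (fun t w => (N t w)%:R) &
      forall s t : R, 0 <= s -> s < t -> forall k : nat,
        P [set w | (N t w)%:R - (N s w)%:R = k%:R :> R] =
        (poisson_pmf (lambda * (t - s)) k)%:E].

End processes.

Section model.
Context {R : realType} {d : measure_display} {Omega : measurableType d}.
Variable P : probability Omega R.
Variables (m lambda : R).
Variables (W : R -> {RV P >-> R}) (N : R -> {RV P >-> nat}).
Variable (Y : nat -> {RV P >-> R}).

Definition independent_components : Prop :=
  mutually_independent P (fun i : 'I_3 =>
    nth set0 [:: sigma_family [set t : R | 0 <= t] (fun t w => W t w);
                 sigma_family [set t : R | 0 <= t] (fun t w => N t w);
                 sigma_family [set: nat] (fun i w => Y i w)] i).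

(* [Y i] is the jump of index i + 1. *)
Definition jump_diffusion (t : R) (w : Omega) : R :=
  m * t + W t w + \sum_(i < N t w) Y i w.

Definition hitting_time (x : R) (w : Omega) : \bar R :=
  ereal_inf [set t%:E | t in [set t : R | 0 <= t /\ x <= jump_diffusion t w]].

(* The n-th jump time of the counting process N; it is 0 for n = 0. *)
Definition jump_time (n : nat) (w : Omega) : \bar R :=
  ereal_inf [set t%:E | t in [set t : R | 0 <= t /\ (n <= N t w)%N]].

(* T_{N_t}; the infimum is finite, since t itself is a time at which N has
   reached N_t. *)
Definition last_jump_time (t : R) (w : Omega) : R :=
  fine (jump_time (N t w) w).

(* Density at time u of the first passage of m t + W_t at level z. *)
Definition drifted_bm_hitting_density (u z : R) : R :=
  if 0 < u then
    `|z| / Num.sqrt (2 * pi * u ^+ 3) * expR (- (z - m * u) ^+ 2 / (2 * u))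
  else 0.

(* (1 - F_Y)(y) *)
Definition jump_tail (y : R) : R := 1 - fine (cdf (Y 0%N) y).

Definition hitting_density (t x : R) : \bar R :=
  (lambda%:E *
     'E_P[(fun w => (\1_[set w | (t%:E < hitting_time x w)%E] w : R)
            * jump_tail (x - jump_diffusion t w))%R]
   + 'E_P[(fun w =>
       (\1_[set w | ((last_jump_time t w)%:E < hitting_time x w)%E] w : R)
       * drifted_bm_hitting_density (t - last_jump_time t w)
           (x - jump_diffusion (last_jump_time t w) w))%R])%E.

End model.

(* Main.v *)
(* Let T be the last jump time before t and M the running supremum of the path.
   Almost surely the path is continuous at t, T is locally constant in t, and M_t, M_T
   differ from x; then the two integrands converge pointwise when (t, x) varies.
   That P(M_T = x) = 0, as well as the absence of atoms of X_t, comes from one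
   anticoncentration principle: for e > 0 the Gaussian variable W_e has a bounded density
   and is independent of the increments of W after e, of N and of Y, so W_e + V gives mass
   O(h) to an interval of length h whenever V is a function of the latter; and the
   supremum of X over [e, T] is W_e + V up to grid approximation.
   The first integrand is bounded.  The second is not: its density f(u, z) is
   O(1 / max(u, z^2)).  But {f > K} forces a jump of N in the O(1/K) units of time
   before t and, by the same principle, |x - X_T| = O(1/sqrt K), so it has probability
   O(K^(-3/2)), uniformly for t in a compact set.  This gives uniform integrability. *)
Require Import Defs.
From mathcomp Require Import all_boot all_order all_algebra finmap.
From mathcomp Require Import ring lra.
From mathcomp Require Import all_classical all_reals all_analysis.
From mathcomp Require Import measurable_realfun.

Set Implicit Arguments.
Unset Strict Implicit.
Unset Printing Implicit Defensive.

Import Order.TTheory GRing.Theory Num.Theory.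
Import numFieldNormedType.Exports.

Local Open Scope classical_set_scope.
Local Open Scope ring_scope.

(** * Measure-theoretic tools *)

(** Regularity of the paths holds only almost surely and [P] need not be complete, so neither
    integrand is known to be measurable. Each is the almost sure limit of measurable grid
    functionals, hence measurable off a null set, and the integral of a nonnegative function, a
    supremum over simple functions below it, does not see that null set. Likewise, exceptional
    events are not measured directly but covered by measurable sets of small probability. The time e
    must be positive because the bound on the density of W_e is of order e^(-1/2). Leaving out
    [0, e] is harmless for a level x > 0: by right-continuity and X_0 = 0 the path stays below x/2
    on a short interval, so a supremum equal to x is approached after some time 1/(j+1). With K =
    4^j the tail K^(-3/2) becomes 8^(-j), and raising a truncation from 4^j to 4^(j+1) costs at most
    4^(j+1) 8^(-j), which is summable. *)

Lemma measurable_true {d : measure_display} {T : measurableType d}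
    (f : T -> bool) : measurable_fun setT f -> measurable [set w | f w].
Proof.
move=> /(_ measurableT [set true] I); rewrite setTI.
by rewrite [X in measurable X](_ : _ = [set w | f w]).
Qed.

Lemma measurable_preimage {d d' : measure_display} {T : measurableType d}
    {T' : measurableType d'} (f : T -> T') (B : set T') :
  measurable_fun setT f -> measurable B -> measurable (f @^-1` B).
Proof. by move=> mf mB; rewrite -[X in measurable X]setTI; exact: mf. Qed.

Section independence_tools.
Context {R : realType} {d : measure_display} {Omega : measurableType d}.
Variable P : probability Omega R.
Local Open Scope ereal_scope.

(** For a fixed [E], the events satisfying the product rule with [E] form a lambda-system, so
    Dynkin's theorem extends the rule from an intersection-stable class. *)
Lemma indep_generated (E : set Omega) (G : set (set Omega)) :
  measurable E -> G `<=` measurable -> setI_closed G ->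
  (forall A, G A -> P (E `&` A) = P E * P A) ->
  forall A, <<s G >> A -> measurable A /\ P (E `&` A) = P E * P A.
Proof.
move=> mE mG GI GE A sGA.
have fE : P E \is a fin_num by exact: fin_num_measure.
suff H : <<s G >> `<=` [set A | measurable A /\ P (E `&` A) = P E * P A].
  exact: H.
apply: lambda_system_subset => //.
  apply/dynkin_lambda_system; split => /=.
  - by split => //; rewrite setIT probability_setT mule1.
  - move=> B [mB PB]; split; first exact: measurableC.
    have fB : P B \is a fin_num by exact: fin_num_measure.
    rewrite -setDE measureD ?PB ?probability_setC ?muleBr ?mule1//.
      by congr (_ - _); exact: PB.
    by rewrite ltey_eq fE.
  - move=> F tF FH; have mF n : measurable (F n) by case: (FH n).
    split; first exact: bigcupT_measurable.
    rewrite setI_bigcupr measure_bigcup//; last 2 first.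
      by move=> i _; exact: measurableI.
      by move=> i j _ _ [w [[_ Fi] [_ Fj]]]; apply: tF => //; exists w.
    rewrite measure_bigcup// -(fineK fE) -nneseriesZl//.
    apply: eq_eseriesr => i _; rewrite (fineK fE).
    by case: (FH i).
by move=> B GB; split; [exact: mG|exact: GE].
Qed.

Lemma lt_pinfty_probability (A : set Omega) : measurable A -> P A < +oo.
Proof. by move=> mA; rewrite ltey_eq fin_num_measure. Qed.

(* Cut the range of [V] into intervals of length [h] and use independence on each. *)
Lemma anticoncentration_indep (U V : Omega -> R) (A : set Omega) (K : R) :
  (0 <= K)%R -> measurable_fun setT U -> measurable_fun setT V -> measurable A ->
  (forall (c h : R), (0 < h)%R ->
    P (U @^-1` `[c, (c + h)%R]) <= (K * h)%:E) ->
  (forall (B C : set R), measurable B -> measurable C ->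
    P (U @^-1` B `&` (A `&` V @^-1` C)) = P (U @^-1` B) * P (A `&` V @^-1` C)) ->
  forall (x h : R), (0 < h)%R ->
    P (A `&` [set w | `|U w + V w - x| <= h]%R) <= (3 * K * h)%:E * P A.
Proof.
move=> K0 mU mV mA Uconc UV x h h0.
(* The cells are indexed by the integer floor(v / h), encoded as a natural number to allow countable
   sums; a code that is not reached gives an empty cell. *)
pose I k : set R := [set v : R | choice.pickle (Num.floor (v / h)) = k].
have mI k : measurable (I k).
  have [[v Iv]|/set0P/negP/negPn/eqP->] := pselect (exists v, I k v); last by [].
  have -> : I k = `[((Num.floor (v / h))%:~R * h)%R,
                    ((Num.floor (v / h) + 1)%:~R * h)%R[%classic.
    apply/seteqP; split => y /=.
      rewrite /I/= in Iv * => Iy; rewrite in_itv /= -ler_pdivlMr// -ltr_pdivrMr//.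
      have -> : Num.floor (v / h) = Num.floor (y / h).
        apply: (pcan_inj (@choice.pickleK int)); exact: etrans Iv (esym Iy).
      by rewrite floor_le_tmp floorD1_gt.
    rewrite in_itv /= -ler_pdivlMr// -ltr_pdivrMr// => /floor_def yv.
    by rewrite /I/= yv.
  exact: measurable_itv.
have mVI k : measurable (A `&` V @^-1` I k).
  by apply: measurableI => //; exact: measurable_preimage.
have mUB (B : set R) : measurable B -> measurable (U @^-1` B).
  exact: measurable_preimage.
have tVI : trivIset setT (fun k => A `&` V @^-1` I k).
  by move=> i j _ _ [w [[_ <-] [_ <-]]].
have AE : A = \bigcup_k (A `&` V @^-1` I k).
  apply/seteqP; split => w; last by case=> k _ [].
  by move=> Aw; exists (choice.pickle (Num.floor (V w / h))).
have mE : measurable (A `&` [set w | `|U w + V w - x| <= h]%R).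
  apply: measurableI => //; apply: measurable_true.
  apply: measurable_fun_ler => //.
  apply: measurableT_comp => //; apply: measurable_funB => //.
  exact: measurable_funD.
have key k : P (A `&` [set w | `|U w + V w - x| <= h]%R `&` V @^-1` I k) <=
    (3 * K * h)%:E * P (A `&` V @^-1` I k).
  have [[v Iv]|] := pselect (exists v, I k v); last first.
    move=> /set0P/negP/negPn/eqP->; rewrite preimage_set0 !setI0 measure0.
    by rewrite mule0.
  pose z := Num.floor (v / h).
  (* For V in [zh, zh + h), the condition |U + V - x| <= h confines U to an interval of length 3h;
     this is the origin of the factor 3. *)
  pose B := `[(x - h - (z%:~R * h + h))%R,
              (x - h - (z%:~R * h + h) + 3 * h)%R]%classic.
  apply: (@le_trans _ _ (P (U @^-1` B `&` (A `&` V @^-1` I k)))).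
    apply: le_measure; rewrite ?inE//.
    - by apply: measurableI => //; exact: measurable_preimage.
    - apply: measurableI (mUB _ _) (mVI k); exact: measurable_itv.
    move=> w [[Aw]] /= + Iw; rewrite ler_norml => /andP[H1 H2].
    split; last by split.
    rewrite /B /= in_itv/=.
    have Iz : z = Num.floor (V w / h).
      apply: (pcan_inj (@choice.pickleK int)); rewrite /I /= in Iv Iw.
      exact: etrans Iv (esym Iw).
    have : (z%:~R * h <= V w)%R by rewrite -ler_pdivlMr// Iz floor_le_tmp.
    have : (V w < (z + 1)%:~R * h)%R by rewrite -ltr_pdivrMr// Iz floorD1_gt.
    by rewrite intrD mulrDl mul1r; lra.
  rewrite (UV _ _ (measurable_itv _) (mI k)).
  apply: lee_wpmul2r; first exact: measure_ge0.
  by apply: (le_trans (Uconc _ _ _)); [lra|rewrite lee_fin; lra].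
rewrite [X in P X <= _](_ : _ = \bigcup_k
    (A `&` [set w | `|U w + V w - x| <= h]%R `&` V @^-1` I k)); last first.
  apply/seteqP; split => w; last by case=> k _ [].
  by move=> Ew; exists (choice.pickle (Num.floor (V w / h))).
rewrite measure_bigcup//; last 2 first.
  by move=> k _; apply: measurableI => //; exact: measurable_preimage.
  by move=> i j _ _ [w [[_ <-] [_ <-]]].
rewrite [in leRHS]AE [in leRHS]measure_bigcup// -nneseriesZl//.
by apply: lee_nneseries => // k _; exact: key.
Qed.

End independence_tools.

(** * Null sets, integrands measurable up to a null set, uniform integrability *)

Section null_sets.
Context {R : realType} {d : measure_display} {Omega : measurableType d}.
Variable P : probability Omega R.
Local Open Scope ereal_scope.

(** The cover is the lower limit of the [E n]. It is an increasing union of sets each contained in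
    all later [E n], so continuity from below preserves the bound. *)
Lemma liminf_cover (E : nat -> set Omega) (c : \bar R) :
  (forall n, measurable (E n)) -> (\forall n \near \oo, P (E n) <= c) ->
  exists B, [/\ measurable B, P B <= c &
    forall w, (\forall n \near \oo, E n w) -> B w].
Proof.
move=> mE Ec; pose F n := \bigcap_(k in [set k | (n <= k)%N]) E k.
have mF n : measurable (F n).
  by apply: bigcap_measurable => //; exists n => /=.
have mB : measurable (\bigcup_n F n) by exact: bigcupT_measurable.
exists (\bigcup_n F n); split => //.
- have ndF : {homo F : n m / (n <= m)%N >-> (n <= m)%O}.
    by move=> n m nm; apply/subsetPset => w Fw k /= mk; apply: Fw; exact: leq_trans mk.
  have cvP := @nondecreasing_cvg_mu _ _ _ P _ mF mB ndF.
  rewrite -(cvg_lim _ cvP)//; apply: lime_le.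
    by apply/cvg_ex; exists (P (\bigcup_n F n)).
  near=> n; apply: (@le_trans _ _ (P (E n))).
    apply: le_measure; rewrite ?inE//.
    by move=> w /(_ n); apply => /=.
  by near: n.
Unshelve. all: by end_near. Qed.

Lemma negligible_small_cover (A : set Omega) :
  (forall e : R, (0 < e)%R ->
    exists B, [/\ measurable B, A `<=` B & P B <= e%:E]) -> P.-negligible A.
Proof.
move=> H; have /choice[B HB] : forall n : nat, exists B,
    [/\ measurable B, A `<=` B & P B <= n.+1%:R^-1%:E].
  by move=> n; apply: H; rewrite invr_gt0.
have mB : measurable (\bigcap_n B n).
  by apply: bigcapT_measurable => n; case: (HB n).
exists (\bigcap_n B n); split => //; last by move=> w Aw n _; case: (HB n) => _ + _; exact.
apply/eqP; rewrite -measure_le0; apply/lee_addgt0Pr => e e0; rewrite add0e.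
have [n] := ltr_add_invr e0; rewrite add0r => ne.
apply: (@le_trans _ _ (P (B n))).
  by apply: le_measure; rewrite ?inE//; [case: (HB n)|move=> w; exact].
by case: (HB n) => _ _ /le_trans; apply; rewrite lee_fin ltW.
Qed.

(* [P] need not be complete, hence the explicit null set. *)
Definition null_mod (N : set Omega) (f : Omega -> R) :=
  [/\ measurable N, P N = 0 & measurable_fun setT (fun w => f w * \1_(~` N) w)%R].

(** Cutting everything off on a measurable null set that contains the points of non-convergence
    makes the convergence hold everywhere. *)
Lemma ae_cvg_null_mod (f_ : nat -> Omega -> R) (f : Omega -> R) :
  (forall n, measurable_fun setT (f_ n)) ->
  {ae P, forall w, f_ n w @[n --> \oo] --> f w} ->
  exists N, null_mod N f.
Proof.
move=> mf [N [mN N0 fN]]; exists N; split => //.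
apply: (@measurable_fun_cvg _ _ _ _ (fun n w => f_ n w * \1_(~` N) w)%R).
  move=> n; apply: measurable_funM => //.
  by apply: measurable_indic; exact: measurableC.
move=> w _; rewrite indicE; have [Nw|Nw] := pselect (N w).
  rewrite memNset; last by move=> /(_ Nw).
  by under eq_fun do rewrite mulr0; rewrite mulr0; exact: cvg_cst.
rewrite mem_set//; apply: cvgM; last exact: cvg_cst.
by apply: contrapT => h; apply: Nw; apply: fN.
Qed.

(** The integral of a nonnegative function is a supremum over simple functions below it, and
    enlarging the function enlarges this family. *)
Lemma ge0_le_integral_nonmeas (f g : Omega -> \bar R) :
  (forall w, 0 <= f w) -> (forall w, f w <= g w) ->
  \int[P]_w f w <= \int[P]_w g w.
Proof.
move=> f0 fg; rewrite !ge0_integralTE//; last by move=> w; exact: le_trans (fg w).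
apply: ereal_sup_le => _ [h /= hf <-]; exists h => //= w.
exact: le_trans (hf w) (fg w).
Qed.

Lemma integral_null_mod (N : set Omega) (f : Omega -> R) :
  (forall w, 0 <= f w)%R -> null_mod N f ->
  \int[P]_w (f w)%:E = \int[P]_w (f w * \1_(~` N) w)%:E.
Proof.
move=> f0 [mN N0 mf]; apply/eqP; rewrite eq_le; apply/andP; split; last first.
  apply: ge0_le_integral_nonmeas => w.
    by rewrite lee_fin mulr_ge0.
  rewrite lee_fin indicE; case: (_ \in _); first by rewrite mulr1.
  by rewrite mulr0.
(* The value +oo on the null set makes [g] a measurable majorant of [f], whatever [f] does there, at
   no cost in the integral. *)
pose g w := if w \in N then +oo else (f w * \1_(~` N) w)%:E.
have mg : measurable_fun setT g.
  apply: measurable_fun_ifT => //; last exact/measurable_EFinP.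
  apply: (measurable_fun_bool true) => //.
  rewrite setTI [X in measurable X](_ : _ = N)//.
  by apply/seteqP; split => w /=; [move/set_mem|move/mem_set].
rewrite (@ae_eq_integral _ _ _ P setT g (fun w => (f w * \1_(~` N) w)%:E))//.
- apply: ge0_le_integral_nonmeas => w; first by rewrite lee_fin.
  rewrite /g; case: ifPn => wN; first by rewrite leey.
  by rewrite indicE in_setC wN mulr1.
- exact/measurable_EFinP.
- exists N; split => // w /= h; apply: contrapT => Nw; apply: h => _.
  by rewrite /g memNset.
Qed.

(** Raising the truncation level from 4^k to 4^(k+1) adds at most 4^(k+1) P(G > 4^k) <= 4c / 2^k;
    summing over k >= n gives 8c / 2^n. *)
Lemma uniform_integrability_tail (G : Omega -> R) (c : R) (n : nat) :
  (forall w, 0 <= G w)%R -> (0 <= c)%R -> measurable_fun setT G ->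
  (forall j, (n <= j)%N -> P [set w | 4 ^+ j < G w]%R <= (c / 8 ^+ j)%:E) ->
  \int[P]_w (G w)%:E <=
  \int[P]_w (Num.min (G w) (4 ^+ n))%:E + (8 * c / 2 ^+ n)%:E.
Proof.
move=> G0 c0 mG tail.
have mmin k : measurable_fun setT (fun w => (Num.min (G w) (4 ^+ k))%:E).
  by apply/measurable_EFinP; apply: measurable_minr.
have min0 k w : (0 <= (Num.min (G w) (4 ^+ k))%:E :> \bar R).
  by rewrite lee_fin le_min G0 exprn_ge0.
have mt k : measurable [set w | 4 ^+ k < G w]%R.
  by apply: measurable_true; apply: measurable_fun_ltr.
(* The difference of inverse powers is the exact partial sum of the geometric series, so each
   induction step closes with an equality. *)
have step k : \int[P]_w (Num.min (G w) (4 ^+ (n + k)))%:E <=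
    \int[P]_w (Num.min (G w) (4 ^+ n))%:E +
    (8 * c * ((2 ^+ n)^-1 - (2 ^+ (n + k))^-1))%:E.
  elim: k => [|k IH]; first by rewrite addn0 subrr mulr0 adde0.
  apply: (@le_trans _ _ (\int[P]_w ((Num.min (G w) (4 ^+ (n + k)))%:E +
      (4 ^+ (n + k.+1) * \1_[set w | 4 ^+ (n + k) < G w]%R w)%:E))).
    apply: ge0_le_integral => //.
      apply: emeasurable_funD => //; apply/measurable_EFinP.
      by apply: measurable_funM => //; apply: measurable_indic.
    move=> w _; rewrite -EFinD lee_fin indicE.
    have p4 : (4 ^+ (n + k) <= 4 ^+ (n + k.+1) :> R)%R.
      by rewrite ler_eXn2l// ?leq_add2l//; lra.
    have [GwN|GwN] := leP (G w) (4 ^+ (n + k))%R.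
      rewrite memNset ?mulr0 ?addr0 /=; last by rewrite ltNge GwN.
      by rewrite min_l// (le_trans GwN).
    rewrite mem_set// mulr1 (@le_trans _ _ (4 ^+ (n + k.+1))%R)//.
      by rewrite ge_min lexx orbT.
    by rewrite lerDr exprn_ge0.
  rewrite ge0_integralD//; last first.
    apply/measurable_EFinP.
    by apply: measurable_funM => //; apply: measurable_indic.
  under [X in _ + X <= _]eq_integral do rewrite EFinM.
  rewrite ge0_integralZl//; last first.
    by apply/measurable_EFinP; apply: measurable_indic.
  rewrite integral_indic// setIT.
  apply: (le_trans (leeD IH (lee_wpmul2l _ (tail _ (leq_addr _ _))))).
    by rewrite lee_fin exprn_ge0.
  rewrite -EFinM -addeA -EFinD leeD2l// lee_fin.
  have -> : (8 = 2 ^+ 3 :> R)%R by rewrite !exprS expr0; lra.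
  have -> : (4 = 2 ^+ 2 :> R)%R by rewrite !exprS expr0; lra.
  rewrite -!exprM addnS mulnS (mulnC 2%N) (mulnC 3%N) (exprD _ 2) !exprM (exprS _ (n + k)).
  set a := (2 ^+ (n + k))%R; set b := (2 ^+ n)%R.
  have a0 : (a != 0)%R by rewrite expf_neq0.
  have b0 : (b != 0)%R by rewrite expf_neq0.
  rewrite le_eqVlt; apply/orP; left; apply/eqP.
  by field; rewrite a0 b0.
have cvG : \int[P]_w (Num.min (G w) (4 ^+ (n + k)))%:E @[k --> \oo] -->
    \int[P]_w (G w)%:E.
  have -> : \int[P]_w (G w)%:E = \int[P]_w (limn (fun k =>
      (Num.min (G w) (4 ^+ (n + k)))%:E)).
    apply: eq_integral => w _; apply/esym/cvg_lim => //.
    apply: cvg_near_cst.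
    have [k Gk] : exists k, (G w <= 4 ^+ (n + k))%R.
      exists (Num.truncn (G w)).+1.
      rewrite (le_trans (ltW (truncnS_gt _)))// -natrX ler_nat.
      apply: (leq_trans (ltnW (ltn_expl _ (isT : (1 < 4)%N)))).
      by rewrite leq_exp2l// leq_addl.
    exists k => // j /= kj; rewrite min_l// (le_trans Gk)//.
    by rewrite ler_eXn2l ?leq_add2l//; lra.
  apply: cvg_monotone_convergence => // w _ a b ab.
  rewrite lee_fin le_min ge_min lexx/= ge_min; apply/orP; right.
  by rewrite ler_eXn2l ?leq_add2l//; lra.
rewrite -(cvg_lim _ cvG)//; apply: lime_le; first by apply/cvg_ex; eexists; exact: cvG.
apply: nearW => k; apply: (le_trans (step k)).
rewrite leeD2l// lee_fin ler_wpM2l ?mulr_ge0//.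
by rewrite lerBlDr lerDl invr_ge0 exprn_ge0.
Qed.

End null_sets.

(** * Sample paths *)

Section paths.
Context {R : realType} {d : measure_display} {Omega : measurableType d}.
Context {P : probability Omega R}.
Variables (m : R) (W : R -> {RV P >-> R}) (N : R -> {RV P >-> nat}).
Variable (Y : nat -> {RV P >-> R}).

Definition regular_path (w : Omega) : Prop :=
  [/\ W 0 w = 0, N 0 w = 0%N,
      {within `[0, +oo[, continuous (fun t : R => W t w)},
      (forall s t : R, 0 <= s -> s <= t -> (N s w <= N t w)%N) &
      (forall t : R, 0 <= t -> N s w @[s --> t^'+] --> N t w)].

Definition locally_constant_at (t : R) (w : Omega) : Prop :=
  exists2 e : R, 0 < e & forall s, 0 <= s -> `|s - t| < e -> N s w = N t w.

Variable w : Omega.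
Hypothesis w_reg : regular_path w.

Local Notation X t := (jump_diffusion m W N Y t w).
Local Notation hit x := (hitting_time m W N Y x w).

Lemma regular_pathW (t e : R) : 0 <= t -> 0 < e ->
  exists2 r, 0 < r & forall s, 0 <= s -> `|s - t| < r -> `|W s w - W t w| < e.
Proof.
case: w_reg => _ _ /continuous_within_itvcyP[Wpos W0] _ _ t0 e0.
move: t0; rewrite le_eqVlt => /predU1P[<-|t0].
  have /cvgrPdist_lt/(_ _ e0)[r /= r0 H] := W0.
  exists r => // s; rewrite le_eqVlt => /predU1P[<-|s0 sr].
    by move=> _; rewrite subrr normr0.
  by rewrite distrC; apply: H => //=; rewrite distrC.
have /Wpos : t \in `]0, +oo[ by rewrite in_itv /= t0.
move=> /cvgrPdist_lt/(_ _ e0)[r /= r0 H].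
exists r => // s _ st; rewrite distrC.
by apply: H => /=; rewrite distrC.
Qed.

Lemma regular_pathN (t : R) : 0 <= t ->
  exists2 r, 0 < r & forall s, t <= s -> s < t + r -> N s w = N t w.
Proof.
case: w_reg => _ _ _ _ /[apply] /(_ _ (discrete_set1 _))[r /= r0 H].
exists r => // s; rewrite le_eqVlt => /predU1P[<-//|ts sr].
by apply: H => //=; rewrite ltr_distlC; apply/andP; split; lra.
Qed.

(** When [N] has the same value at both times the jump sums cancel, and only the drift and [W]
    vary. *)
Lemma diffusion_modulus (t e : R) : 0 <= t -> 0 < e ->
  exists2 r, 0 < r & forall s, 0 <= s -> N s w = N t w -> `|s - t| < r ->
    `|X s - X t| < e.
Proof.
move=> t0 e0; have e20 : 0 < e / 2 by rewrite divr_gt0.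
have [r r0 Hr] := regular_pathW t0 e20.
(* Adding 1 keeps the divisor positive when m = 0. *)
have M0 : 0 < `|m| + 1 by rewrite ltr_pwDr.
exists (Num.min r (e / 2 / (`|m| + 1))).
  by rewrite lt_min r0 divr_gt0.
move=> s s0 Nst; rewrite lt_min => /andP[sr sm].
rewrite /jump_diffusion Nst.
have -> : m * s + W s w + \sum_(i < N t w) Y i w -
    (m * t + W t w + \sum_(i < N t w) Y i w) =
    m * (s - t) + (W s w - W t w) by ring.
apply: (le_lt_trans (ler_normD _ _)); rewrite normrM.
have := Hr _ s0 sr.
have : `|m| * `|s - t| <= (`|m| + 1) * `|s - t| by rewrite ler_wpM2r// lerDl.
by move: sm; rewrite ltr_pdivlMr// mulrC; lra.
Qed.

Lemma diffusion_right_cts (t e : R) : 0 <= t -> 0 < e ->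
  exists2 r, 0 < r & forall s, t <= s -> s < t + r -> `|X s - X t| < e.
Proof.
move=> t0 e0; have [r r0 Hr] := diffusion_modulus t0 e0.
have [r' r'0 Hr'] := regular_pathN t0.
exists (Num.min r r'); first by rewrite lt_min r0.
move=> s ts; rewrite -ltrBlDl lt_min => /andP[sr sr'].
apply: Hr; [exact: le_trans ts|apply: Hr' => //; lra|].
by rewrite ger0_norm ?subr_ge0.
Qed.

Lemma diffusion_cts (t e : R) : 0 <= t -> 0 < e -> locally_constant_at t w ->
  exists2 r, 0 < r & forall s, 0 <= s -> `|s - t| < r -> `|X s - X t| < e.
Proof.
move=> t0 e0 [r' r'0 Hr']; have [r r0 Hr] := diffusion_modulus t0 e0.
exists (Num.min r r'); first by rewrite lt_min r0.
by move=> s s0; rewrite lt_min => /andP[sr sr']; apply: Hr => //; exact: Hr'.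
Qed.

(** Right-continuity of the integer-valued [N] makes the infimum attained. The last equivalence
    locates the jump time by comparing values of [N], which is how it is read off a grid. *)
Lemma last_jump_timeP (t : R) (T := last_jump_time N t w) : 0 <= t ->
  [/\ 0 <= T, T <= t, N T w = N t w &
      forall s, 0 <= s -> (s < T) = (N s w < N t w)%N].
Proof.
move=> t0; case: (w_reg) => _ _ _ Nmono _.
pose S := [set s : R | 0 <= s /\ (N t w <= N s w)%N].
have St : S t by [].
have lS : has_lbound S by exists 0 => s [].
have hS : has_inf S by split => //; exists t.
have TE : T = inf S by rewrite /T /last_jump_time /jump_time ereal_inf_EFin//; exists t.
have T0 : 0 <= T by rewrite TE; apply: lb_le_inf; [exists t|move=> s []].
have Tt : T <= t by rewrite TE; exact: ge_inf.
have NT : (N t w <= N T w)%N.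
  have [r r0 Hr] := regular_pathN T0.
  have [s [s0 Ns]] := inf_adherent r0 hS; rewrite -TE => sr.
  by rewrite -(Hr s)// TE; exact: ge_inf.
split => //; first by apply/eqP; rewrite eqn_leq NT Nmono.
move=> s s0; rewrite [RHS]ltnNge [LHS]ltNge; congr (~~ _).
apply/idP/idP => [Ts|Ns]; first exact: leq_trans NT (Nmono _ _ T0 Ts).
by rewrite TE; apply: ge_inf.
Qed.

Lemma hitting_time_le (x s T : R) :
  0 <= s -> s <= T -> x <= X s -> (hit x <= T%:E)%E.
Proof.
move=> s0 sT xs; apply: (@le_trans _ _ s%:E); last by rewrite lee_fin.
by apply: ereal_inf_lbound; exists s.
Qed.

(** The hitting time is an infimum, so the strict inequality needs a margin from [T] to [T'] free of
    hits. *)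
Lemma lt_hitting_time (x T T' : R) : T < T' ->
  (forall s, 0 <= s -> s < T' -> X s < x) -> (T%:E < hit x)%E.
Proof.
move=> TT' H; apply: (@lt_le_trans _ _ T'%:E); first by rewrite lte_fin.
apply: le_ereal_inf_tmp => _ [s [s0 xs] <-]; rewrite lee_fin leNgt.
by apply/negP => sT'; move: (H s s0 sT'); rewrite ltNge xs.
Qed.

(* [x] is not the supremum of the path over [0, T]. *)
Definition off_supremum (T x : R) : Prop :=
  (exists2 c, c < x & forall s, 0 <= s -> s <= T -> X s <= c) \/
  (exists s, [/\ 0 <= s, s <= T & x < X s]).

Lemma not_off_supremum (T x : R) : ~ off_supremum T x ->
  (forall s, 0 <= s -> s <= T -> X s <= x) /\
  (forall c, c < x -> exists s, [/\ 0 <= s, s <= T & c < X s]).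
Proof.
move=> /not_orP[H1 H2]; split => [s s0 sT|c cx].
  by rewrite leNgt; apply/negP => xs; apply: H2; exists s.
apply: contrapT => H; apply: H1; exists c => // s s0 sT.
by rewrite leNgt; apply/negP => cs; apply: H; exists s.
Qed.

(** Below the level, right-continuity at [T] carries a strict bound slightly past [T]; above it, a
    time of strict excess also works for all nearby levels. *)
Lemma hitting_time_stable_level (T x : R) (x_ : nat -> R) : 0 <= T ->
  off_supremum T x -> x_ n @[n --> \oo] --> x ->
  \forall n \near \oo, (T%:E < hit (x_ n))%E = (T%:E < hit x)%E.
Proof.
move=> T0 [[c cx Hc]|[s [s0 sT xs]]] xx.
  have e0 : 0 < (x - c) / 2 by lra.
  have [r r0 Hr] := diffusion_right_cts T0 e0.
  have HX s : 0 <= s -> s < T + r -> X s < c + (x - c) / 2.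
    move=> s0 sT; have [sT'|Ts] := leP s T.
      by apply: (le_lt_trans (Hc s s0 sT')); lra.
    have := Hr s (ltW Ts) sT; rewrite ltr_norml => /andP[_].
    by have := Hc T T0 (lexx _); lra.
  have /cvgrPdist_lt/(_ _ e0) := xx; apply: filterS => n.
  rewrite ltr_norml => /andP[n1 n2].
  have TTr : T < T + r by lra.
  by rewrite !(@lt_hitting_time _ T (T + r))// => s s0 sT; have := HX s s0 sT; lra.
have e0 : 0 < X s - x by lra.
have /cvgrPdist_lt/(_ _ e0) := xx; apply: filterS => n.
rewrite ltr_norml => /andP[n1 n2].
rewrite !ltNge !(@hitting_time_le _ s)//; lra.
Qed.

Lemma hitting_time_stable (t x : R) (t_ x_ : nat -> R) : 0 < t ->
  locally_constant_at t w -> off_supremum t x ->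
  t_ n @[n --> \oo] --> t -> x_ n @[n --> \oo] --> x ->
  \forall n \near \oo, ((t_ n)%:E < hit (x_ n))%E = (t%:E < hit x)%E.
Proof.
move=> t0 tc [[c cx Hc]|[s [s0 sT xs]]] tt xx.
  have e0 : 0 < (x - c) / 2 by lra.
  have [r r0 Hr] := diffusion_right_cts (ltW t0) e0.
  have HX s : 0 <= s -> s < t + r -> X s < c + (x - c) / 2.
    move=> s0 sT; have [sT'|Ts] := leP s t.
      by apply: (le_lt_trans (Hc s s0 sT')); lra.
    have := Hr s (ltW Ts) sT; rewrite ltr_norml => /andP[_].
    by have := Hc t (ltW t0) (lexx _); lra.
  have /cvgrPdist_lt/(_ _ e0) H1 := xx.
  have /cvgrPdist_lt/(_ _ r0) H2 := tt.
  apply: filterS2 H1 H2 => n.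
  rewrite !ltr_norml => /andP[n1 n2] /andP[n3 n4].
  have T1 : t < t + r by lra.
  have T2 : t_ n < t + r by lra.
  by rewrite !(@lt_hitting_time _ _ (t + r))// => s s0 sT; have := HX s s0 sT; lra.
(* The times [t_ n] may approach t from below, so an excess seen only at t must first be moved to an
   earlier time; this uses continuity at t. *)
have [s' [s'0 s't xs']] : exists s', [/\ 0 <= s', s' < t & x < X s'].
  move: sT; rewrite le_eqVlt => /predU1P[st|st]; last by exists s.
  have e0 : 0 < X t - x by rewrite -st; lra.
  have [r r0 Hr] := diffusion_cts (ltW t0) e0 tc.
  pose s' := Num.max 0 (t - r / 2).
  have s't : s' < t by rewrite gt_max t0; lra.
  have s'0 : 0 <= s' by rewrite le_max lexx.
  have s'r : t - r / 2 <= s' by rewrite le_max lexx orbT.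
  exists s'; split => //.
  have : `|s' - t| < r by rewrite ltr_norml; apply/andP; split; lra.
  move=> /(Hr _ s'0); rewrite ltr_norml => /andP[]; lra.
have e0 : 0 < X s' - x by lra.
have t'0 : 0 < t - s' by lra.
have /cvgrPdist_lt/(_ _ e0) H1 := xx.
have /cvgrPdist_lt/(_ _ t'0) H2 := tt.
apply: filterS2 H1 H2 => n.
rewrite !ltr_norml => /andP[n1 n2] /andP[n3 n4].
rewrite !ltNge !(@hitting_time_le _ s')//; lra.
Qed.

End paths.

(** * Grid approximation of the running supremum *)

Section grid.
Context {R : realType}.

Definition grid (t : R) (n k : nat) : R := t * k%:R / n.+1%:R.

Lemma grid0 t n : grid t n 0 = 0. Proof. by rewrite /grid mulr0 mul0r. Qed.

Lemma grid_full t n : grid t n n.+1 = t.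
Proof. by rewrite /grid mulfK. Qed.

Lemma gridS t n k : grid t n k.+1 = grid t n k + t / n.+1%:R.
Proof. by rewrite /grid -natr1 mulrDr mulr1 mulrDl. Qed.

Lemma ler_grid t n : 0 < t -> {mono grid t n : j k / (j <= k)%N >-> j <= k}.
Proof.
by move=> t0 j k; rewrite /grid ler_pM2r ?invr_gt0// ler_pM2l// ler_nat.
Qed.

Lemma ltr_grid t n : 0 < t -> {mono grid t n : j k / (j < k)%N >-> j < k}.
Proof. by move=> t0 j k; rewrite !ltNge ler_grid// ltnNge. Qed.

Lemma grid_ge0 t n k : 0 < t -> 0 <= grid t n k.
Proof. by move=> t0; rewrite -(grid0 t n) ler_grid. Qed.

Lemma mesh_cvg0 (t e : R) : 0 < e -> \forall n \near \oo, t / n.+1%:R < e.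
Proof.
move=> e0; have := near_infty_natSinv_lt (PosNum (divr_gt0 e0 (ltr_pwDr ltr01 (normr_ge0 t)))).
apply: filterS => n /=; rewrite -[X in X < _ -> _]div1r ltr_pdivrMr// => H.
rewrite ltr_pdivrMr//; apply: (le_lt_trans (ler_norm t)).
have M0 : 0 < `|t| + 1 by rewrite ltr_pwDr.
move: H; rewrite mulrAC ltr_pdivlMr// mul1r; lra.
Qed.

Lemma grid_approx (t s : R) n : 0 < t -> 0 <= s ->
  exists k, s <= grid t n k /\ grid t n k < s + t / n.+1%:R.
Proof.
move=> t0 s0; have h0 : 0 < t / n.+1%:R by rewrite divr_gt0.
have [|k Hk] := @ex_minnP (fun k => s <= grid t n k).
  exists (Num.truncn (s / (t / n.+1%:R))).+1.
  rewrite /grid mulrAC mulrC -ler_pdivrMr//; exact/ltW/truncnS_gt.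
move=> Hmin; exists k; split => //.
case: k Hk Hmin => [|k] Hk Hmin; first by rewrite grid0 ltr_wpDl.
by rewrite gridS ltrD2r ltNge; apply/negP => /Hmin; rewrite ltnn.
Qed.

(** The first grid point at or after [T]. Approaching [T] from the right suits paths that are only
    right-continuous. *)
Definition grid_index_of (t T : R) (n g : nat) : Prop :=
  [/\ (g <= n.+1)%N, T <= grid t n g & grid t n g < T + t / n.+1%:R].

(** A downward closed predicate holds on an initial segment, so counting finds where it first fails.
    A finite sum of indicators replaces a search and is visibly measurable. *)
Lemma sum_initial_segment (p : nat -> bool) n :
  (forall j k, (j <= k)%N -> p k -> p j) ->
  let g := (\sum_(k < n) p k)%N in
  [/\ (g <= n)%N, (g < n)%N -> ~~ p g & (0 < g)%N -> p g.-1].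
Proof.
move=> pdown; elim: n => [|n [gn pg pg1]] /=; first by rewrite big_ord0.
rewrite big_ord_recr /=; set g := (\sum_(k < n) p k)%N in gn pg pg1 *.
have [pn|pn] := boolP (p n); rewrite ?addn1 ?addn0.
  have -> : g = n.
    apply/eqP; rewrite eqn_leq gn leqNgt; apply/negP => lt_gn.
    by have := pg lt_gn; rewrite (pdown _ n)// ltnW.
  by split => //; rewrite ltnn.
split; [exact: leqW| |exact: pg1].
rewrite ltnS leq_eqVlt => /predU1P[->//|]; exact: pg.
Qed.

End grid.

(** * Limits of grid functionals along a regular path *)

Section grid_paths.
Context {R : realType} {d : measure_display} {Omega : measurableType d}.
Context {P : probability Omega R}.
Variables (m : R) (W : R -> {RV P >-> R}) (N : R -> {RV P >-> nat}).
Variable (Y : nat -> {RV P >-> R}).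

Local Notation X t w := (jump_diffusion m W N Y t w).

(* The number of grid points before the last jump time, i.e., the index of the first
   grid point after it. *)
Definition jump_index (t : R) (n : nat) (w : Omega) : nat :=
  (\sum_(k < n.+1) (N (grid t n k) w < N t w))%N.

(* For [e <= T] and [g] the grid index of [T], an approximation of the supremum of
   the path over [e, T]. *)
Definition grid_max (t e : R) (n g : nat) (w : Omega) : R :=
  \big[Num.max/X e w]_(k < n.+2)
    (if (k <= g)%N && (e <= grid t n k) then X (grid t n k) w else X e w).

Lemma grid_max_ltP t e n g w x : reflect
  (X e w < x /\ forall k, (k <= n.+1)%N -> (k <= g)%N -> e <= grid t n k ->
     X (grid t n k) w < x)
  (grid_max t e n g w < x).
Proof.
apply: (iffP (bigmax_ltP _ _ _ _)) => -[Xe H]; split => //.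
  move=> k kn kg ek; have /= := H (Ordinal (kn : (k < n.+2)%N)) isT.
  by rewrite kg ek.
move=> k _; case: ifPn => // /andP[kg ek]; apply: H => //.
by rewrite -ltnS.
Qed.

Lemma le_grid_max t e n g w k : (k <= n.+1)%N -> (k <= g)%N -> e <= grid t n k ->
  X (grid t n k) w <= grid_max t e n g w.
Proof.
move=> kn kg ek; rewrite leNgt; apply/negP => /grid_max_ltP[_ /(_ k kn kg ek)].
by rewrite ltxx.
Qed.

Variable w : Omega.
Hypothesis w_reg : regular_path W N w.
Variables (t : R).
Hypothesis t0 : 0 < t.

Lemma jump_indexP n : grid_index_of t (last_jump_time N t w) n (jump_index t n w).
Proof.
have [T0 Tt NT ltT] := last_jump_timeP w_reg (ltW t0).
set T := last_jump_time N t w in T0 Tt NT ltT *.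
have h0 : 0 < t / n.+1%:R by rewrite divr_gt0.
have := @sum_initial_segment (fun k => (N (grid t n k) w < N t w)%N) n.+1.
rewrite /= -/(jump_index t n w); set g := jump_index t n w.
case.
  move=> j k jk; rewrite -!ltT ?grid_ge0//; apply: le_lt_trans.
  by rewrite ler_grid.
rewrite -!ltT ?grid_ge0// -leNgt => gn Tg gT; split => //.
  (* If all the points of index at most n precede the jump, the index is n + 1, whose grid point is
     t itself. *)
  by move: gn; rewrite leq_eqVlt => /predU1P[->|//]; rewrite grid_full.
have [g0|] := posnP g; first by rewrite g0 grid0 ltr_wpDl.
by move=> g0; rewrite -(prednK g0) gridS ltrD2r; exact: gT.
Qed.

Section approximations.
Variables (T : R) (g : nat -> nat).
Hypotheses (T0 : 0 <= T) (gT : forall n, grid_index_of t T n (g n)).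

Lemma near_grid_index (r : R) : 0 < r ->
  \forall n \near \oo, T <= grid t n (g n) /\ grid t n (g n) < T + r.
Proof.
move=> r0; have := mesh_cvg0 t r0; apply: filterS => n hr.
by case: (gT n) => _ H1 /lt_trans H2; split => //; apply: H2; rewrite ltrD2l.
Qed.

Lemma cvg_grid_index : grid t n (g n) @[n --> \oo] --> T.
Proof.
apply/cvgrPdist_lt => e e0; have := near_grid_index e0; apply: filterS => n [].
by move=> H1 H2; rewrite ltr_norml; apply/andP; split; lra.
Qed.

Lemma cvg_diffusion_grid_index : X (grid t n (g n)) w @[n --> \oo] --> X T w.
Proof.
apply/cvgrPdist_lt => e e0; have [r r0 Hr] := diffusion_right_cts m Y w_reg T0 e0.
have := near_grid_index r0; apply: filterS => n [H1 H2].
by rewrite distrC; exact: Hr.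
Qed.

Lemma grid_max_upper (e x c : R) : c < x -> X e w <= c ->
  (forall s, e <= s -> 0 <= s -> s <= T -> X s w <= c) ->
  \forall n \near \oo, grid_max t e n (g n) w < x.
Proof.
move=> cx Xe Xc; have d0 : 0 < x - c by lra.
have [r r0 Hr] := diffusion_right_cts m Y w_reg T0 d0.
(* When T < e the radius also keeps the grid point of index [g n] below e; then no index is eligible
   and the maximum is the default [X e w]. *)
have r'0 : 0 < (if T < e then Num.min r (e - T) else r).
  by case: ifPn => // Te; rewrite lt_min r0 subr_gt0.
have := near_grid_index r'0; apply: filterS => n [H1 H2].
apply/grid_max_ltP; split; first lra.
move=> k kn kg ek; have [kT|Tk] := leP (grid t n k) T.
  by have := Xc _ ek (grid_ge0 _ _ t0) kT; lra.
have gk : grid t n k <= grid t n (g n) by rewrite ler_grid.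
move: H2; have [Te|eT] := ltP T e.
  by rewrite -ltrBlDl lt_min => /andP[_]; lra.
move=> H2; have Tk' : grid t n k < T + r by exact: le_lt_trans H2.
have := Hr _ (ltW Tk) Tk'; rewrite ltr_norml => /andP[_].
by have := Xc _ eT T0 (lexx T); lra.
Qed.

Lemma grid_max_lower (e x s : R) : 0 <= s -> e <= s -> s <= T -> x < X s w ->
  \forall n \near \oo, x < grid_max t e n (g n) w.
Proof.
move=> s0 es sT xX; have d0 : 0 < X s w - x by lra.
have [r r0 Hr] := diffusion_right_cts m Y w_reg s0 d0.
have := mesh_cvg0 t r0; apply: filterS => n hr.
have [k [sk ks]] := grid_approx n t0 s0.
case: (gT n) => gn H1 H2.
(* The grid point k lies less than a mesh above s <= T, hence strictly before the successor of
   [g n]. *)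
have kg : (k <= g n)%N.
  rewrite -ltnS -(ltr_grid n t0) gridS (lt_le_trans ks)// lerD2r.
  exact: le_trans H1.
apply: (@lt_le_trans _ _ (X (grid t n k) w)).
  have ksr : grid t n k < s + r by rewrite (lt_trans ks)// ltrD2l.
  by have := Hr _ sk ksr; rewrite ltr_norml => /andP[]; lra.
apply: le_grid_max => //; first exact: leq_trans kg gn.
exact: le_trans sk.
Qed.

(** The comparison with the grid maximum is measurable and eventually decides the event on the
    right, for which measurability is not directly available. *)
Lemma grid_max_off_supremum (x : R) : off_supremum m W N Y w T x ->
  \forall n \near \oo, (grid_max t 0 n (g n) w < x) =
    (T%:E < hitting_time m W N Y x w)%E.
Proof.
move=> [[c cx Hc]|[s [s0 sT xs]]].
  have d0 : 0 < x - c by lra.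
  have -> : (T%:E < hitting_time m W N Y x w)%E.
    have [r r0 Hr] := diffusion_right_cts m Y w_reg T0 d0.
    apply: (@lt_hitting_time _ _ _ _ _ _ _ _ _ _ _ (T + r)); first lra.
    move=> s s0 sT; have [sT'|Ts] := leP s T; first by have := Hc s s0 sT'; lra.
    have := Hr s (ltW Ts) sT; rewrite ltr_norml => /andP[_].
    by have := Hc T T0 (lexx _); lra.
  apply: (@grid_max_upper _ _ c) => //; first exact: Hc.
  by move=> s _; exact: Hc.
have -> : (T%:E < hitting_time m W N Y x w)%E = false.
  apply/negbTE; rewrite -leNgt.
  by apply: (@hitting_time_le _ _ _ _ _ _ _ _ _ _ s) => //; exact: ltW.
have := grid_max_lower s0 s0 sT xs; apply: filterS => n H.
by apply/negbTE; rewrite -leNgt ltW.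
Qed.

(** Near time 0 the path stays below x / 2, so a supremum equal to x is approached after that. The
    starting time depends on the path; inverses of integers keep the possibilities countable. *)
Lemma grid_max_at_supremum (x : R) : 0 < x -> ~ off_supremum m W N Y w T x ->
  exists j : nat, grid_max t (j.+1%:R^-1) n (g n) w @[n --> \oo] --> x.
Proof.
move=> x0 /not_off_supremum[Xx Xc].
have x20 : 0 < x / 2 by lra.
have [r r0 Hr] := diffusion_right_cts m Y w_reg (lexx 0) x20.
have X0 : X 0 w = 0.
  case: w_reg => W0 N0 _ _ _.
  by rewrite /jump_diffusion W0 N0 big_ord0 mulr0 !addr0.
have [j] := ltr_add_invr r0; rewrite add0r => jr; exists j.
set e := j.+1%:R^-1 in jr *.
have e0 : 0 < e by rewrite invr_gt0.
have Xe s : 0 <= s -> s <= e -> X s w < x / 2.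
  move=> s0 se; have sr : s < 0 + r by lra.
  by have := Hr s s0 sr; rewrite X0 subr0 ltr_norml => /andP[].
apply/cvgrPdist_lt => z z0.
have [|s [s0 sT cX]] := Xc (Num.max (x - z) (x / 2)).
  by rewrite gt_max; apply/andP; split; lra.
move: cX; rewrite gt_max => /andP[cX1 cX2].
have es : e <= s by rewrite leNgt; apply/negP => /ltW /(Xe s s0); lra.
have up : \forall n \near \oo, grid_max t e n (g n) w < x + z.
  apply: (@grid_max_upper _ _ x); [lra| |by move=> ? _; exact: Xx].
  by have := Xe e (ltW e0) (lexx _); lra.
have low := grid_max_lower s0 es sT cX1.
by apply: filterS2 up low => n ? ?; rewrite ltr_norml; apply/andP; split; lra.
Qed.

End approximations.
End grid_paths.

(** * The first-passage density of drifted Brownian motion *)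

Section density.
Context {R : realType}.
Variable m : R.
Local Notation f := (drifted_bm_hitting_density m).

Lemma density_ge0 (u z : R) : 0 <= f u z.
Proof.
rewrite /drifted_bm_hitting_density; by case: ifPn => // u0; rewrite mulr_ge0 ?expR_ge0.
Qed.

(** The chain is (1+a)^3 <= (1+a)^4 <= 4 (1+a^2)^2 <= 64 (1+a^2/4)^2 <= 64 exp(a^2/2), the last step
    being the square of 1 + y <= exp y at y = a^2/4. *)
Lemma gauss_cube_bound (a : R) : 0 <= a -> (1 + a) ^+ 3 * expR (- (a ^+ 2 / 2)) <= 64.
Proof.
move=> a0; have E : (1 + a ^+ 2 / 4) ^+ 2 <= expR (a ^+ 2 / 2).
  have -> : expR (a ^+ 2 / 2) = expR (a ^+ 2 / 4) ^+ 2.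
    by rewrite -expRM_natl; congr expR; lra.
  rewrite lerXn2r ?nnegrE ?expR_ge0 ?addr_ge0 ?divr_ge0 ?sqr_ge0//.
  exact: expR_ge1Dx.
rewrite expRN ler_pdivrMr ?expR_gt0//.
apply: (@le_trans _ _ (64 * (1 + a ^+ 2 / 4) ^+ 2)); last by rewrite ler_wpM2l.
apply: (@le_trans _ _ ((1 + a) ^+ 4)).
  by rewrite [leRHS]exprSr ler_peMr ?exprn_ge0//; lra.
apply: (@le_trans _ _ (4 * (1 + a ^+ 2) ^+ 2)); last first.
  have : 0 <= a ^+ 2 by rewrite sqr_ge0.
  set b := a ^+ 2 => b0.
  have : (1 + b) ^+ 2 <= (4 * (1 + b / 4)) ^+ 2.
    by rewrite lerXn2r ?nnegrE//; lra.
  by rewrite exprMn; lra.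
have -> : 4 * (1 + a ^+ 2) ^+ 2 = (2 * (1 + a ^+ 2)) ^+ 2 by rewrite exprMn; lra.
have -> : (1 + a) ^+ 4 = ((1 + a) ^+ 2) ^+ 2 by rewrite -exprM.
rewrite lerXn2r ?nnegrE ?sqr_ge0//; last first.
  have : 0 <= (1 - a) ^+ 2 by rewrite sqr_ge0.
  rewrite !sqrrD !sqrrN; lra.
by rewrite mulr_ge0// addr_ge0// sqr_ge0.
Qed.

(* Scaling by [Num.sqrt u] reduces this to the boundedness of a cubic against a
   Gaussian. *)
Lemma density_bound (M : R) : exists2 C, 0 < C & forall u z, 0 < u -> u <= M ->
  f u z * u <= C /\ f u z * z ^+ 2 <= C.
Proof.
(* Bounds the shift m sqrt(u) that the drift causes in the normalized variable, for u <= M. *)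
pose L := `|m| * Num.sqrt M.
have L0 : 0 <= L by rewrite mulr_ge0// sqrtr_ge0.
exists (64 * (1 + L) ^+ 3); first by rewrite mulr_gt0// exprn_gt0//; lra.
move=> u z u0 uM; rewrite /drifted_bm_hitting_density u0.
pose q := Num.sqrt u; have q0 : 0 < q by rewrite sqrtr_gt0.
have uE : u = q ^+ 2 by rewrite sqr_sqrtr// ltW.
pose y := (z - m * u) / q.
have -> : - (z - m * u) ^+ 2 / (2 * u) = - (`|y| ^+ 2 / 2).
  rewrite real_normK ?num_real// /y uE; field; lra.
set E := expR _; have E0 : 0 <= E by rewrite expR_ge0.
have zs : `|z| / q <= `|y| + L.
  have <- : `|z / q| = `|z| / q by rewrite normrM normfV (gtr0_norm q0).
  have -> : z / q = y + m * q by rewrite /y uE; field; lra.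
  rewrite (le_trans (ler_normD _ _))// lerD2l normrM (gtr0_norm q0).
  rewrite ler_wpM2l// ler_sqrt//; exact: le_trans (ltW u0) uM.
have D0 : u * q <= Num.sqrt (2 * pi * u ^+ 3).
  have -> : u * q = Num.sqrt (u ^+ 3).
    have -> : u ^+ 3 = (u * q) ^+ 2 by rewrite exprMn -uE exprSr.
    by rewrite sqrtr_sqr ger0_norm// mulr_ge0// ltW.
  rewrite ler_wsqrtr//.
  by rewrite ler_peMl ?exprn_ge0 ?ltW//; have := @pi_ge2 R; lra.
have uq0 : 0 < u * q by rewrite mulr_gt0.
have fle : `|z| / Num.sqrt (2 * pi * u ^+ 3) * E <= `|z| / (u * q) * E.
  rewrite ler_wpM2r// ler_wpM2l// lef_pV2// posrE//.
  exact: lt_le_trans D0.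
(* In this variable the density times u is at most s E, and times z^2 at most s^3 E; (1 + s)^3 E
   dominates both. *)
pose s := `|z| / q; have s0 : 0 <= s by rewrite divr_ge0// ltW.
have sE : (1 + s) ^+ 3 * E <= 64 * (1 + L) ^+ 3.
  apply: (@le_trans _ _ (((1 + L) * (1 + `|y|)) ^+ 3 * E)).
    rewrite ler_wpM2r//; apply: lerXn2r; rewrite ?nnegrE; [lra| |].
      by rewrite mulr_ge0 ?addr_ge0.
    have : 0 <= L * `|y| by rewrite mulr_ge0.
    rewrite /s; lra.
  rewrite exprMn -mulrA mulrC ler_wpM2r ?exprn_ge0 ?addr_ge0//.
  exact: gauss_cube_bound.
have c1 : s <= (1 + s) ^+ 3.
  by apply: (@le_trans _ _ (1 + s)); [lra|rewrite ler_eXnr//; lra].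
have c2 : s ^+ 3 <= (1 + s) ^+ 3 by rewrite lerXn2r ?nnegrE; lra.
split.
  apply: (le_trans (ler_wpM2r (ltW u0) fle)).
  have -> : `|z| / (u * q) * E * u = s * E by rewrite /s; field; lra.
  by apply: le_trans sE; rewrite ler_wpM2r.
apply: (le_trans (ler_wpM2r (sqr_ge0 z) fle)).
have -> : `|z| / (u * q) * E * z ^+ 2 = s ^+ 3 * E.
  rewrite /s uE -[z ^+ 2]real_normK ?num_real//; field; lra.
by apply: le_trans sE; rewrite ler_wpM2r.
Qed.

Lemma cvg_density {T : Type} (F : set_system T) {FF : Filter F} (u_ z_ : T -> R) (u z : R) :
  0 < u -> u_ n @[n --> F] --> u -> z_ n @[n --> F] --> z ->
  f (u_ n) (z_ n) @[n --> F] --> f u z.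
Proof.
move=> u0 uu zz.
have up : \forall n \near F, 0 < u_ n.
  have /cvgrPdist_lt/(_ _ u0) := uu; apply: filterS => n.
  by rewrite ltr_norml => /andP[]; lra.
rewrite [X in _ --> X](_ : _ = `|z| / Num.sqrt (2 * pi * u ^+ 3) *
    expR (- (z - m * u) ^+ 2 / (2 * u))); last first.
  by rewrite /drifted_bm_hitting_density u0.
apply: (@cvg_trans _ ((`|z_ n| / Num.sqrt (2 * pi * u_ n ^+ 3) *
    expR (- (z_ n - m * u_ n) ^+ 2 / (2 * u_ n))) @[n --> F])).
  apply: near_eq_cvg; apply: filterS up => n un.
  by rewrite /drifted_bm_hitting_density un.
have sq0 : Num.sqrt (2 * pi * u ^+ 3) != 0.
  by rewrite gt_eqF// sqrtr_gt0 mulr_gt0 ?exprn_gt0// mulr_gt0// pi_gt0.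
apply: cvgM.
  apply: cvgM; first exact: cvg_norm.
  apply: cvgV => //; apply: (continuous_cvg _ (@sqrt_continuous R _)).
  apply: cvgM; first exact: cvg_cst.
  exact: (continuous_cvg _ (@exprn_continuous R 3 u)).
apply: (continuous_cvg _ (@continuous_expR R _)).
apply: cvgM.
  apply: cvgN; apply: (continuous_cvg _ (@exprn_continuous R 2 _)).
  by apply: cvgB => //; apply: cvgM => //; exact: cvg_cst.
apply: cvgV; first by rewrite mulf_neq0// gt_eqF.
by apply: cvgM => //; exact: cvg_cst.
Qed.

Lemma measurable_density (u : R) : measurable_fun setT (f u).
Proof.
rewrite /drifted_bm_hitting_density.
case: (ltP 0 u) => u0; last exact: measurable_cst.
apply: measurable_funM.
  apply: measurable_funM; last exact: measurable_cst.
  exact: normr_measurable.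
apply: measurableT_comp => //; apply: measurable_funM => //.
apply: measurableT_comp => //; apply: measurable_funX.
exact: measurable_funB.
Qed.

End density.

(** * Independence of W_e from the later increments *)

Section measurability.
Context {d : measure_display} {T : measurableType d} {R : realType}.

(** Splitting along the countably many values of the index replaces joint measurability. *)
Lemma measurable_nat_index (F : nat -> T -> R) (g : T -> nat) :
  measurable_fun setT g -> (forall k, measurable_fun setT (F k)) ->
  measurable_fun setT (fun w => F (g w) w).
Proof.
move=> mg mF _ B mB; rewrite setTI.
rewrite [X in measurable X](_ : _ =
    \bigcup_k ((g @^-1` [set k]) `&` (F k @^-1` B))); last first.
  apply/seteqP; split => w /=; first by move=> Bw; exists (g w).
  by case=> k _ [/= ->].
apply: bigcupT_measurable => k; apply: measurableI; first exact: measurable_preimage.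
exact: measurable_preimage.
Qed.

Lemma measurable_bigmaxr (I : Type) (s : seq I) (F : I -> T -> R) (x : T -> R) :
  measurable_fun setT x -> (forall i, measurable_fun setT (F i)) ->
  measurable_fun setT (fun w => \big[Num.max/x w]_(i <- s) F i w).
Proof.
move=> mx mF; elim: s => [|i s IH].
  by under eq_fun do rewrite big_nil.
under eq_fun do rewrite big_cons.
exact: measurable_maxr.
Qed.

Lemma measurable_sum_nat_of_bool (I : Type) (s : seq I) (p : I -> T -> bool) :
  (forall i, measurable_fun setT (p i)) ->
  measurable_fun setT (fun w => (\sum_(i <- s) p i w)%N).
Proof.
move=> mp; elim: s => [|i s IH].
  by under eq_fun do rewrite big_nil; exact: measurable_cst.
under eq_fun do rewrite big_cons.
apply: measurable_fun_addn => //.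
exact: (@measurableT_comp _ _ _ _ _ _ (fun b : bool => nat_of_bool b)).
Qed.

Lemma measurable_compound (Nf : T -> nat) (Yf : nat -> T -> R) :
  measurable_fun setT Nf -> (forall i, measurable_fun setT (Yf i)) ->
  measurable_fun setT (fun w => \sum_(i < Nf w) Yf i w).
Proof.
move=> mN mY; apply: (measurable_nat_index (F := fun k w => \sum_(i < k) Yf i w)) => // k.
exact: measurable_sum.
Qed.

End measurability.

Section increments.
Context {R : realType} {d : measure_display} {Omega : measurableType d}.
Context {P : probability Omega R}.
Variables (m : R) (W : R -> {RV P >-> R}) (N : R -> {RV P >-> nat}).
Variable (Y : nat -> {RV P >-> R}).
Variables (t e : R) (n : nat).

Local Notation X t w := (jump_diffusion m W N Y t w).

(** The sequence 0, e, then the grid points clipped from below at e. It is nondecreasing and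
    infinite, as independence of increments requires, and clipped points only give zero
    increments. *)
Definition increment_time (i : nat) : R :=
  if i is k.+1 then Num.max e (grid t n k) else 0.

Definition increment (i : nat) (w : Omega) : R :=
  W (increment_time i.+1) w - W (increment_time i) w.

(* The increment of index 0 is the one over [0, e], which is excluded here. *)
Definition increment_cylinder : set (set Omega) :=
  [set S | exists A : nat -> set Omega,
    [/\ forall i, sigma_rv (increment i) (A i), A 0%N = setT,
        exists k, forall i, (k < i)%N -> A i = setT & S = \bigcap_i A i]].

(** An intersection-stable class generating the information in [N], in [Y] and in the grid
    increments of [W] after e; on its members independence is a product formula. *)
Definition future_events : set (set Omega) :=
  [set S | exists A B C, [/\ increment_cylinder A,
     sigma_family [set t : R | 0 <= t] (fun t w => N t w) B,
     sigma_family [set: nat] (fun i w => Y i w) C & S = A `&` B `&` C]].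

Lemma sigma_family_setI {d' : measure_display} {E : measurableType d'}
    (I : Type) (D : set I) (Z : I -> Omega -> E) : setI_closed (sigma_family D Z).
Proof.
move=> A B HA HB; rewrite /sigma_family.
exact: (@measurableI _ (g_sigma_algebraType (\bigcup_(i in D) sigma_rv (Z i)))).
Qed.

Lemma sigma_rvI {d' : measure_display} {E : measurableType d'}
    (Z : Omega -> E) : setI_closed (sigma_rv Z).
Proof.
move=> _ _ [A mA <-] [B mB <-]; exists (A `&` B); first exact: measurableI.
by rewrite !setTI.
Qed.

Lemma sigma_rvT {d' : measure_display} {E : measurableType d'}
    (Z : Omega -> E) : sigma_rv Z setT.
Proof. by exists setT => //; rewrite preimage_setT setTI. Qed.

Lemma future_events_setI : setI_closed future_events.
Proof.
move=> _ _ [A [B [C [[a [aA a0 [ka aka] ->]] HB HC ->]]]]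
  [A' [B' [C' [[b [bA b0 [kb bkb] ->]] HB' HC' ->]]]].
exists (\bigcap_i (a i `&` b i)), (B `&` B'), (C `&` C'); split.
- exists (fun i => a i `&` b i); split => //.
  + by move=> i; exact: sigma_rvI.
  + by rewrite a0 b0 setIT.
  + exists (maxn ka kb) => i; rewrite gtn_max => /andP[/aka -> /bkb ->].
    by rewrite setIT.
- exact: sigma_family_setI.
- exact: sigma_family_setI.
- rewrite bigcapI.
  apply/seteqP; split => w /=; tauto.
Qed.

Lemma sigma_family_measurable {d' : measure_display} {E : measurableType d'}
    (I : Type) (D : set I) (Z : I -> Omega -> E) :
  (forall i, D i -> measurable_fun setT (Z i)) ->
  sigma_family D Z `<=` @measurable _ Omega.
Proof.
move=> mZ; apply: smallest_sub; first exact: sigma_algebra_measurable.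
by move=> A [i Di [B mB <-]]; exact: mZ.
Qed.

(** Places cylinders of increments in the sigma-algebra of [W], where independence of the components
    applies. Index 0 is unconstrained, so the initial increment is covered too. *)
Lemma increment_cylinder_sub (A : nat -> set Omega) : 0 <= e -> 0 < t ->
  (forall i, sigma_rv (increment i) (A i)) ->
  sigma_family [set t : R | 0 <= t] (fun t w => W t w) (\bigcap_i A i).
Proof.
move=> e0 t0 HA; rewrite /sigma_family.
set G := \bigcup_(i in _) _.
have itime0 i : 0 <= increment_time i.
  by case: i => [|i] //=; rewrite le_max e0.
have mW s : 0 <= s -> measurable_fun setT ((fun w => W s w) : g_sigma_algebraType G -> R).
  move=> s0 _ B mB; apply: sub_sigma_algebra; exists s => //; exists B => //.
apply: (@bigcapT_measurable _ (g_sigma_algebraType G)) => i.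
case: (HA i) => B mB <-.
apply: (@measurable_funB _ (g_sigma_algebraType G) R setT
  (fun w => W (increment_time i.+1) w) (fun w => W (increment_time i) w)) => //.
- exact: mW.
- exact: mW.
Qed.

Lemma future_events_measurable : 0 <= e -> 0 < t -> future_events `<=` @measurable _ Omega.
Proof.
move=> e0 t0 _ [A [B [C [[a [aA a0 _ ->]] HB HC ->]]]].
apply: measurableI; last by apply: sigma_family_measurable HC.
apply: measurableI; last by apply: sigma_family_measurable HB.
by apply: sigma_family_measurable (increment_cylinder_sub e0 t0 aA).
Qed.

Hypothesis W_bm : brownian_motion W.
Hypothesis WNY : independent_components W N Y.
Hypotheses (e0 : 0 <= e) (t0 : 0 < t).

Lemma independent_components3 (A B C : set Omega) :
  sigma_family [set t : R | 0 <= t] (fun t w => W t w) A ->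
  sigma_family [set t : R | 0 <= t] (fun t w => N t w) B ->
  sigma_family [set: nat] (fun i w => Y i w) C ->
  P (A `&` B `&` C) = (P A * P B * P C)%E.
Proof.
move=> HA HB HC.
pose S (i : 'I_3) := nth set0 [:: A; B; C] i.
pose i0 : 'I_3 := Ordinal (isT : (0 < 3)%N).
pose i1 : 'I_3 := Ordinal (isT : (1 < 3)%N).
pose i2 : 'I_3 := Ordinal (isT : (2 < 3)%N).
have := WNY (J := (i0 |` (i1 |` [fset i2]))%fset) (A := S).
rewrite !big_fsetU1 ?big_seq_fset1 ?inE//= muleA => <-.
  congr (P _); apply/seteqP; split => [w [[Aw Bw] Cw] i /=|w H].
    by rewrite !inE => /or3P[] /eqP ->.
  by split; [split|]; [apply: (H i0)|apply: (H i1)|apply: (H i2)]; rewrite /= !inE eqxx ?orbT.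
by move=> i; rewrite !inE => /or3P[] /eqP ->.
Qed.

Lemma increments_independent (E S : set Omega) : sigma_rv (increment 0) E ->
  increment_cylinder S -> P (E `&` S) = (P E * P S)%E.
Proof.
move=> HE [A [HA A0 [k Ak] ->]].
case: W_bm => _ _ W_indep _.
have tau0 : 0 <= increment_time 0 by [].
have tauS i : increment_time i <= increment_time i.+1.
  case: i => [|i] /=; first by rewrite le_max e0.
  by rewrite ge_max le_max lexx /= le_max ler_grid// leqnSn orbT.
have ind := W_indep _ tau0 tauS.
(* Only the coordinates 1 to k of the cylinder are nontrivial, and coordinate 0 is free to receive
   [E]. *)
pose J := [fset i in iota 1 k]%fset.
pose A' i := if i == 0%N then E else A i.
have J0 : 0%N \notin J by rewrite !inE mem_iota.
have A'E : {in J, A' =1 A}.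
  by move=> i; rewrite /A'; case: eqP => // ->; rewrite (negbTE J0).
have AJ : \bigcap_i A i = \bigcap_(i in [set` J]) A i.
  apply/seteqP; split => w Aw i; first by move=> _; exact: Aw.
  move=> _; have [i0|i0] := posnP i; first by rewrite i0 A0.
  have [ik|ki] := leqP i k; last by rewrite Ak.
  by apply: Aw; rewrite /= !inE mem_iota add1n ltnS i0.
have -> : E `&` \bigcap_i A i = \bigcap_(i in [set` (0%N |` J)%fset]) A' i.
  rewrite AJ; apply/seteqP; split => w.
    move=> [Ew Aw] i /=; rewrite in_fset1U => /predU1P[->//|iJ].
    by rewrite A'E//; exact: Aw.
  move=> Aw; split; first by apply: (Aw 0%N); rewrite /= in_fset1U eqxx.
  by move=> i /= iJ; rewrite -A'E//; apply: Aw; rewrite /= in_fset1U iJ orbT.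
rewrite AJ ind; last first.
  by move=> i _; rewrite /A'; case: eqP => [->|_]; [exact: HE|exact: HA].
rewrite (ind J A (fun i _ => HA i)) (big_fsetU1 _ _ J0)/=; congr (_ * _)%E.
by apply: eq_big_seq => i /A'E ->.
Qed.

(** Both E and E [&] A belong to the sigma-algebra of [W]: independence of the components splits off
    [B] and [C], and independence of increments then separates [E] from [A]. *)
Lemma initial_increment_independent (E S : set Omega) :
  sigma_rv (increment 0) E -> future_events S -> P (E `&` S) = (P E * P S)%E.
Proof.
move=> HE [A [B [C [HA HB HC ->]]]].
have FA : sigma_family [set t : R | 0 <= t] (fun t w => W t w) A.
  by case: HA => a [Ha _ _ ->]; exact: increment_cylinder_sub.
have FE : sigma_family [set t : R | 0 <= t] (fun t w => W t w) E.
  pose a i := if i == 0%N then E else setT.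
  have -> : E = \bigcap_i a i.
    apply/seteqP; split => w; last by move/(_ 0%N); exact.
    by move=> Ew [|i].
  apply: increment_cylinder_sub => // i; rewrite /a; case: eqP => [->//|_].
  exact: sigma_rvT.
rewrite -!setIA (setIA E) (setIA (E `&` A)).
rewrite (independent_components3 (sigma_family_setI FE FA) HB HC).
rewrite (setIA A) (independent_components3 FA HB HC) increments_independent//.
by rewrite !muleA.
Qed.

Local Notation futureType := (g_sigma_algebraType future_events).

Lemma future_measurable_fun (Z : Omega -> R) :
  measurable_fun setT (Z : futureType -> R) -> measurable_fun setT Z.
Proof.
move=> mZ _ B mB; have := mZ measurableT B mB; apply: smallest_sub => //.
  exact: sigma_algebra_measurable.
exact: future_events_measurable.
Qed.

Lemma future_event_measurable (A : set Omega) :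
  @measurable _ futureType A -> @measurable _ Omega A.
Proof.
apply: smallest_sub => //; first exact: sigma_algebra_measurable.
exact: future_events_measurable.
Qed.

Lemma future_events_indep (E A : set Omega) : sigma_rv (increment 0) E ->
  @measurable _ futureType A -> P (E `&` A) = (P E * P A)%E.
Proof.
move=> HE HA.
have mE : measurable E.
  case: HE => B mB <-; rewrite setTI; apply: measurable_preimage => //.
  exact: measurable_funB.
have [] := @indep_generated _ _ _ P E future_events _ _ _ _ A HA => //.
- exact: future_events_measurable.
- exact: future_events_setI.
- by move=> S; exact: initial_increment_independent.
Qed.

End increments.

(** * Null sets and tail estimates *)

Section estimates.
Context {R : realType} {d : measure_display} {Omega : measurableType d}.
Context {P : probability Omega R}.
Variables (m lambda : R) (W : R -> {RV P >-> R}) (N : R -> {RV P >-> nat}).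
Variable (Y : nat -> {RV P >-> R}).
Hypothesis lambda0 : 0 < lambda.
Hypothesis W_bm : brownian_motion W.
Hypothesis N_pp : poisson_process lambda N.
Hypothesis WNY : independent_components W N Y.

Local Notation X t w := (jump_diffusion m W N Y t w).

(* At times s >= e this is [X s - W e], which does not depend on [W] before e. *)
Definition post_diffusion (e s : R) (w : Omega) : R :=
  m * s + (W (Num.max e s) w - W e w) + \sum_(i < N s w) Y i w.

Definition post_grid_max (t e : R) (n : nat) (g : nat) (w : Omega) : R :=
  \big[Num.max/post_diffusion e e w]_(k < n.+2)
    (if (k <= g)%N && (e <= grid t n k) then post_diffusion e (grid t n k) w
     else post_diffusion e e w).

Lemma post_diffusionE e s w : e <= s -> X s w = W e w + post_diffusion e s w.
Proof.
by move=> es; rewrite /post_diffusion max_r// /jump_diffusion; ring.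
Qed.

(** Translation commutes with maxima, so W_e comes out of the whole maximum as one summand. *)
Lemma grid_max_post t e n g w :
  grid_max m W N Y t e n g w = W e w + post_grid_max t e n g w.
Proof.
rewrite /grid_max /post_grid_max.
rewrite (big_morph (fun x => W e w + x) (id1 := X e w) (op1 := Num.max)); last 2 first.
- by move=> x y; rewrite addr_maxr.
- by rewrite -post_diffusionE.
apply: eq_bigr => k _; case: ifPn => [/andP[_ ek]|_]; exact: post_diffusionE.
Qed.

Section future_measurability.
Variables (t e : R) (n : nat).
Hypotheses (t0 : 0 < t) (e0 : 0 <= e).

Local Notation futureType := (g_sigma_algebraType (future_events W N Y t e n)).

Lemma future_measurableN (s : R) : 0 <= s ->
  measurable_fun setT (N s : futureType -> nat).
Proof.
move=> s0 _ B mB; apply: sub_sigma_algebra.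
exists setT, (N s @^-1` B), setT; split.
- exists (fun=> setT); split => //; first by move=> i; exact: sigma_rvT.
    by exists 0%N.
  by rewrite bigcapT.
- by apply: sub_sigma_algebra; exists s => //; exists B => //; rewrite setTI.
- exact: (@measurableT _ (g_sigma_algebraType (\bigcup_(i in _) sigma_rv (Y i)))).
- by rewrite !setTI setIT.
Qed.

Lemma future_measurableY (j : nat) :
  measurable_fun setT (Y j : futureType -> R).
Proof.
move=> _ B mB; apply: sub_sigma_algebra.
exists setT, setT, (Y j @^-1` B); split.
- exists (fun=> setT); split => //; first by move=> i; exact: sigma_rvT.
    by exists 0%N.
  by rewrite bigcapT.
- exact: (@measurableT _ (g_sigma_algebraType (\bigcup_(i in _) sigma_rv (N i)))).
- by apply: sub_sigma_algebra; exists j => //; exists B => //; rewrite setTI.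
- by rewrite !setTI.
Qed.

Lemma future_measurable_increment (j : nat) : (0 < j)%N ->
  measurable_fun setT (increment W t e n j : futureType -> R).
Proof.
move=> j0 _ B mB; apply: sub_sigma_algebra.
exists (increment W t e n j @^-1` B), setT, setT; split.
- exists (fun i => if i == j then increment W t e n j @^-1` B else setT); split.
  + move=> i; case: eqP => [->|_]; last exact: sigma_rvT.
    by exists B => //; rewrite setTI.
  + by case: eqP j0 => // <-.
  + by exists j => i ji; rewrite gtn_eqF.
  + apply/seteqP; split => w /=; last by move/(_ j I); rewrite eqxx.
    by move=> Bw i _; case: eqP.
- exact: (@measurableT _ (g_sigma_algebraType (\bigcup_(i in _) sigma_rv (N i)))).
- exact: (@measurableT _ (g_sigma_algebraType (\bigcup_(i in _) sigma_rv (Y i)))).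
- by rewrite setTI !setIT.
Qed.

Lemma future_measurableW (k : nat) : measurable_fun setT
  ((fun w => W (Num.max e (grid t n k)) w - W e w) : futureType -> R).
Proof.
(* A telescoping sum: grid point 0 clips to e, so the increments of index 1 to k start there. *)
have -> : (fun w => W (Num.max e (grid t n k)) w - W e w) =
    (fun w => \sum_(i < k) increment W t e n i.+1 w).
  apply/funext => w; elim: k => [|k IH].
    by rewrite big_ord0 grid0 max_l// subrr.
  by rewrite big_ord_recr/= -IH /increment /=; ring.
by apply: (@measurable_sum _ futureType) => i; exact: future_measurable_increment.
Qed.

Lemma future_measurable_grid (k : nat) :
  measurable_fun setT (post_diffusion e (grid t n k) : futureType -> R).
Proof.
apply: (@measurable_funD _ futureType); last first.
  apply: (@measurable_compound _ futureType _ (N (grid t n k)) (fun i => Y i)) => [|i].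
    by apply: future_measurableN; exact: grid_ge0.
  exact: future_measurableY.
apply: (@measurable_funD _ futureType); first exact: measurable_cst.
exact: future_measurableW.
Qed.

Lemma future_measurable_start :
  measurable_fun setT (post_diffusion e e : futureType -> R).
Proof.
apply: (@measurable_funD _ futureType); last first.
  apply: (@measurable_compound _ futureType _ (N e) (fun i => Y i)) => [|i].
    exact: future_measurableN.
  exact: future_measurableY.
rewrite maxxx (_ : (fun w => _) = cst (m * e)); first exact: measurable_cst.
by apply/funext => w; rewrite subrr addr0.
Qed.

Lemma future_measurable_jump_index :
  measurable_fun setT (jump_index N t n : futureType -> nat).
Proof.
apply: (@measurable_sum_nat_of_bool _ futureType _ _
  (fun (i : 'I_n.+1) w => (N (grid t n i) w < N t w)%N)) => i.
apply: (@measurable_fun_ltn _ futureType setT (N (grid t n i)) (N t));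
  apply: future_measurableN => //.
  exact: grid_ge0.
exact: ltW.
Qed.

Lemma future_measurable_grid_max (g : Omega -> nat) :
  measurable_fun setT (g : futureType -> nat) ->
  measurable_fun setT ((fun w => post_grid_max t e n (g w) w) : futureType -> R).
Proof.
move=> mg.
apply: (@measurable_nat_index _ futureType _ (fun k w => post_grid_max t e n k w)) => // k.
apply: (@measurable_bigmaxr _ futureType _ _ _ (fun (i : 'I_n.+2) w =>
    if (i <= k)%N && (e <= grid t n i) then post_diffusion e (grid t n i) w
    else post_diffusion e e w)); first exact: future_measurable_start.
move=> i; case: (_ && _); last exact: future_measurable_start.
exact: future_measurable_grid.
Qed.

End future_measurability.

(** The Gaussian law gives an interval at most the peak of the density times its length. The mesh
    enters only through the sigma-algebra and not the bound, which therefore survives refinement. *)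
Lemma brownian_anticoncentration (t e : R) (n : nat) (A : set Omega)
    (V : Omega -> R) (x h : R) : 0 < t -> 0 < e -> 0 < h ->
  @measurable _ (g_sigma_algebraType (future_events W N Y t e n)) A ->
  measurable_fun setT
    (V : g_sigma_algebraType (future_events W N Y t e n) -> R) ->
  (P (A `&` [set w | `|W e w + V w - x| <= h]%R) <=
    (3 * normal_peak (Num.sqrt e) * h)%:E * P A)%E.
Proof.
move=> t0 e0 h0 mA mV.
have mA' := future_event_measurable (ltW e0) t0 mA.
have mV' := future_measurable_fun (ltW e0) t0 mV.
case: (W_bm) => W0 _ _ W_normal.
pose U w := W e w - W 0 w.
have UE : U = increment W t e n 0 by rewrite /increment /= grid0 max_l// ltW.
have mU : measurable_fun setT U by exact: measurable_funB.
have mS (Z : Omega -> R) : measurable_fun setT Z ->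
    measurable (A `&` [set w | `|Z w + V w - x| <= h]).
  move=> mZ; apply: measurableI => //; apply: measurable_true.
  apply: measurable_fun_ler => //; apply: measurableT_comp => //.
  by apply: measurable_funB => //; exact: measurable_funD.
(* Independence concerns the increment W_e - W_0, and W_0 = 0 only almost surely; the exceptional
   null set is added to the event. *)
have [N0 [mN0 PN0 subN0]] := W0.
apply: (@le_trans _ _ (P (N0 `|` (A `&` [set w | `|U w + V w - x| <= h])))).
  apply: le_measure; rewrite ?inE//.
  - exact: mS.
  - by apply: measurableU => //; exact: mS.
  - move=> w [Aw Hw]; have [Nw|Nw] := pselect (N0 w); first by left.
    right; split => //=; rewrite /U.
    have -> : W 0 w = 0 by apply: contrapT => H; apply: Nw; exact: subN0.
    by rewrite subr0.
apply: (@le_trans _ _ (P N0 + P (A `&` [set w | `|U w + V w - x| <= h]%R))%E).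
  exact: measureU2 mN0 (mS _ mU).
rewrite PN0 add0e.
apply: anticoncentration_indep => //.
- exact: normal_peak_ge0.
- move=> c h' h'0.
  have -> : P (U @^-1` `[c, (c + h')]) = normal_prob 0 (Num.sqrt e) `[c, (c + h')].
    rewrite -[in RHS](subr0 e) -W_normal//.
  rewrite /normal_prob.
  have H := @ge0_le_integral _ _ R (@lebesgue_measure R) `[c, (c + h')]%classic
    (measurable_itv _) (fun y => (normal_pdf 0 (Num.sqrt e) y)%:E)
    (cst (normal_peak (Num.sqrt e))%:E).
  apply: (le_trans (H _ _ _ _)).
  + by move=> y _; rewrite lee_fin normal_pdf_ge0.
  + by apply/measurable_EFinP; apply: measurable_funTS; exact: measurable_normal_pdf.
  + exact: measurable_cst.
  + by move=> y _; rewrite lee_fin normal_pdf_ub// gt_eqF// sqrtr_gt0.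
  rewrite integral_cst//= lebesgue_measure_itv /= lte_fin ltrDl h'0.
  by rewrite -EFinD -EFinM lee_fin addrAC subrr add0r.
- move=> B C mB mC; apply: (future_events_indep W_bm WNY (ltW e0) t0 (n := n)).
    by exists B => //; rewrite setTI UE.
  apply: (@measurableI _ (g_sigma_algebraType (future_events W N Y t e n))) => //.
  exact: (@measurable_preimage _ _ (g_sigma_algebraType (future_events W N Y t e n))).
Qed.

Lemma poisson_jump_bound (s t : R) : 0 <= s -> s < t ->
  measurable [set w | N s w != N t w] /\
  (P [set w | N s w != N t w] <= (lambda * (t - s))%:E)%E.
Proof.
move=> s0 st; case: N_pp => _ _ _ N_poisson.
have mE : measurable [set w | N s w == N t w].
  by apply: measurable_true; exact: measurable_fun_eqn.
have -> : [set w | N s w != N t w] = ~` [set w | N s w == N t w].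
  by apply/seteqP; split => w /= /negP.
split; first exact: measurableC.
rewrite probability_setC//.
have -> : [set w | N s w == N t w] =
    [set w | (N t w)%:R - (N s w)%:R = 0%:R :> R].
  apply/seteqP; split => w /= => [/eqP ->|/eqP]; first by rewrite subrr.
  by rewrite subr_eq0 eqr_nat eq_sym.
rewrite N_poisson// /poisson_pmf mulr_gt0 ?subr_gt0// expr0 fact0 invr1 !mul1r.
rewrite -EFinB lee_fin lerBlDr addrC -lerBlDr.
have := expR_ge1Dx (- (lambda * (t - s))); lra.
Qed.

Lemma ae_regular_path : {ae P, forall w, regular_path W N w}.
Proof.
case: W_bm => W0 Wc _ _; case: N_pp => N0 Nc _ _.
near=> w; split.
- by near: w.
- by near: w.
- by near: w.
- by have [] : (forall s t : R, 0 <= s -> s <= t -> (N s w <= N t w)%N) /\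
    (forall t : R, 0 <= t -> N s w @[s --> t^'+] --> N t w) by near: w.
- by have [] : (forall s t : R, 0 <= s -> s <= t -> (N s w <= N t w)%N) /\
    (forall t : R, 0 <= t -> N s w @[s --> t^'+] --> N t w) by near: w.
Unshelve. all: by end_near. Qed.

(** A jump at t makes [N] differ at t - r and t + r, which has probability at most 2 lambda r; [r]
    is chosen to make this at most z. *)
Lemma ae_locally_constant (t : R) : 0 < t ->
  {ae P, forall w, regular_path W N w -> locally_constant_at N t w}.
Proof.
move=> t0; apply: negligible_small_cover => z z0.
pose r := Num.min (t / 2) (z / (2 * lambda)).
have r0 : 0 < r by rewrite lt_min !divr_gt0// mulr_gt0.
have rt : r < t by rewrite gt_min; apply/orP; left; lra.
have tr0 : 0 <= t - r by lra.
have tr : t - r < t + r by lra.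
have [mA PA] := poisson_jump_bound tr0 tr.
exists [set w | N (t - r) w != N (t + r) w]; split => //.
  move=> w /= /not_implyP[w_reg H]; apply/negP => /eqP Nr; apply: H.
  exists r => // s s0; rewrite ltr_norml => /andP[s1 s2].
  case: w_reg => _ _ _ Nmono _.
  have H1 : (N (t - r) w <= N s w)%N by apply: Nmono; lra.
  have H2 : (N s w <= N (t + r) w)%N by apply: Nmono; lra.
  have H3 : (N (t - r) w <= N t w)%N by apply: Nmono; lra.
  have H4 : (N t w <= N (t + r) w)%N by apply: Nmono; lra.
  apply/eqP; rewrite eqn_leq; rewrite -Nr in H2 H4.
  by rewrite (leq_trans H2 H3) (leq_trans H4 H1).
apply: (le_trans PA); rewrite lee_fin.
have : r <= z / (2 * lambda) by rewrite ge_min lexx orbT.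
rewrite ler_pdivlMr; last by rewrite mulr_gt0.
lra.
Qed.

(** The event [A] is kept apart so that its probability multiplies the small-interval bound: the
    tail estimate needs both factors. *)
Lemma approximation_cover (t e : R) (A Q : set Omega) (V : nat -> Omega -> R)
    (x h : R) : 0 < t -> 0 < e -> 0 < h ->
  (forall n, @measurable _ (g_sigma_algebraType (future_events W N Y t e n)) A) ->
  (forall n, measurable_fun setT
    (V n : g_sigma_algebraType (future_events W N Y t e n) -> R)) ->
  (forall w, Q w -> A w /\ \forall n \near \oo, `|W e w + V n w - x| <= h) ->
  exists B, [/\ measurable B, Q `<=` B &
    (P B <= (3 * normal_peak (Num.sqrt e) * h)%:E * P A)%E].
Proof.
move=> t0 e0 h0 mA mV AQ.
pose E n := A `&` [set w | `|W e w + V n w - x| <= h].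
have mE n : measurable (E n).
  have mA' := future_event_measurable (ltW e0) t0 (mA n).
  apply: (measurableI _ _ mA').
  have mV' := future_measurable_fun (ltW e0) t0 (mV n).
  apply: measurable_true.
  apply: measurable_fun_ler => //; apply: measurableT_comp => //.
  by apply: measurable_funB => //; exact: measurable_funD.
have [] := @liminf_cover _ _ _ P E ((3 * normal_peak (Num.sqrt e) * h)%:E * P A)%E mE.
  apply: nearW => n.
  exact: (brownian_anticoncentration x t0 e0 h0 (mA n) (mV n)).
move=> B [mB PB EB]; exists B; split => // w /AQ[Aw Hw].
by apply: EB; apply: filterS Hw.
Qed.

Lemma normal_peak_cover (e z : R) : 0 < e -> 0 < z ->
  exists2 h, 0 < h & 3 * normal_peak (Num.sqrt e) * h <= z.
Proof.
move=> e0 z0; have K0 : 0 < normal_peak (Num.sqrt e).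
  by apply: normal_peak_gt0; rewrite gt_eqF// sqrtr_gt0.
exists (z / (3 * normal_peak (Num.sqrt e))).
  by rewrite divr_gt0// mulr_gt0.
by rewrite mulrC divfK// gt_eqF// mulr_gt0.
Qed.

Lemma approximation_null (t e : R) (Q : set Omega) (V : nat -> Omega -> R)
    (x : R) : 0 < t -> 0 < e ->
  (forall n, measurable_fun setT
    (V n : g_sigma_algebraType (future_events W N Y t e n) -> R)) ->
  (forall w, Q w -> W e w + V n w @[n --> \oo] --> x) ->
  P.-negligible Q.
Proof.
move=> t0 e0 mV QV; apply: negligible_small_cover => z z0.
have [h h0 hz] := normal_peak_cover e0 z0.
have [n|//|w Qw|B [mB QB PB]] := @approximation_cover t e setT Q V x h t0 e0 h0.
- exact: (@measurableT _ (g_sigma_algebraType (future_events W N Y t e n))).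
- split => //; have /cvgrPdist_le/(_ _ h0) := QV w Qw.
  by apply: filterS => n; rewrite distrC.
exists B; split => //; apply: (le_trans PB).
by rewrite probability_setT mule1 lee_fin.
Qed.

(** The time and its grid index stay abstract to serve both a fixed time and the last jump time.
    Measurability of the index for the future events lets it depend on [N] but not on [W] before
    e. *)
Lemma ae_off_supremum (t x : R) (T : Omega -> R) (g : nat -> Omega -> nat) :
  0 < t -> 0 < x ->
  (forall w, regular_path W N w -> 0 <= T w) ->
  (forall w n, regular_path W N w -> grid_index_of t (T w) n (g n w)) ->
  (forall e n, measurable_fun setT
    (g n : g_sigma_algebraType (future_events W N Y t e n) -> nat)) ->
  {ae P, forall w, regular_path W N w -> off_supremum m W N Y w (T w) x}.
Proof.
move=> t0 x0 T0 gT mg.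
pose Q (j : nat) := [set w | grid_max m W N Y t j.+1%:R^-1 n (g n w) w @[n --> \oo] --> x].
apply: (@negligibleS _ _ _ _ (\bigcup_j Q j)).
  move=> w /= /not_implyP[w_reg].
  move=> /(grid_max_at_supremum w_reg t0 (T0 w w_reg) (fun n => gT w n w_reg) x0)[j Hj].
  by exists j.
apply: negligible_bigcup => j.
have e0 : 0 < j.+1%:R^-1 :> R by rewrite invr_gt0.
apply: (@approximation_null t j.+1%:R^-1 _
  (fun n w => post_grid_max t j.+1%:R^-1 n (g n w) w) x) => //.
- move=> n; apply: future_measurable_grid_max => //; exact: ltW.
- by move=> w; rewrite /Q/=; under eq_fun do rewrite grid_max_post.
Qed.

(** Here e = t: the Gaussian variable is W_t itself, and the approximating sequence is constant. *)
Lemma diffusion_no_atom (t y : R) : 0 < t -> P.-negligible [set w | X t w = y].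
Proof.
move=> t0.
apply: (@approximation_null t t _ (fun n w => post_diffusion t t w) y) => //.
- by move=> n; apply: future_measurable_start => //; exact: ltW.
- move=> w /= <-; rewrite -post_diffusionE//; exact: cvg_cst.
Qed.

(** A last jump within r of t has probability at most lambda r. As T > t - r >= a, the position at T
    is W_a plus a function of future events, which supplies the factor h. *)
Lemma last_jump_cover (t a r x h : R) : 0 < a -> a + r <= t -> 0 < r -> 0 < h ->
  exists B, [/\ measurable B,
    [set w | [/\ regular_path W N w, t - last_jump_time N t w < r &
       `|x - X (last_jump_time N t w) w| < h]] `<=` B &
    (P B <= (3 * normal_peak (Num.sqrt a) * h * (lambda * r))%:E)%E].
Proof.
move=> a0 art r0 h0; have t0 : 0 < t by lra.
pose A := [set w | N (t - r) w != N t w].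
have tr0 : 0 <= t - r by lra.
have trt : t - r < t by lra.
have [mA PA] := poisson_jump_bound tr0 trt.
have [n|n|w [w_reg Tr Xh]|B [mB QB PB]] := @approximation_cover t a A
  [set w | [/\ regular_path W N w, t - last_jump_time N t w < r &
       `|x - X (last_jump_time N t w) w| < h]]
  (fun n w => post_diffusion a (grid t n (jump_index N t n w)) w) x h t0 a0 h0.
- pose FT := g_sigma_algebraType (future_events W N Y t a n).
  have mN s : 0 <= s -> measurable_fun setT (N s : FT -> nat).
    exact: future_measurableN.
  have -> : A = ~` [set w | N (t - r) w == N t w].
    by apply/seteqP; split => w /= /negP.
  apply: (@measurableC _ FT); apply: (@measurable_true _ FT).
  by apply: (@measurable_fun_eqn _ FT setT (N (t - r)) (N t)); apply: mN => //; exact: ltW.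
- apply: (@measurable_nat_index _ (g_sigma_algebraType (future_events W N Y t a n)) _
    (fun k w => post_diffusion a (grid t n k) w)).
    by apply: future_measurable_jump_index.
  by move=> k; apply: future_measurable_grid => //; exact: ltW.
- have [T0 Tt NT ltT] := last_jump_timeP w_reg (ltW t0).
  have Tr' : t - r < last_jump_time N t w by lra.
  split; first by rewrite /A /= ltn_eqF// -ltT.
  have gT n := jump_indexP w_reg t0 n.
  (* The strict inequality leaves slack for replacing the jump time by its grid point. *)
  have d0 : 0 < h - `|x - X (last_jump_time N t w) w| by lra.
  have Xc : X (grid t n (jump_index N t n w)) w @[n --> \oo] -->
      X (last_jump_time N t w) w by exact: cvg_diffusion_grid_index.
  have /cvgrPdist_lt/(_ _ d0) := Xc.
  apply: filterS => n Hn; rewrite -post_diffusionE; last first.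
    by case: (gT n) => _ H _; apply: le_trans H; lra.
  move: Hn; set b := X (grid _ _ _) w; set c := X (last_jump_time N t w) w.
  by have := ler_distD c b x; rewrite (distrC b c) (distrC c x); lra.
exists B; split => //; apply: (le_trans PB).
rewrite [leRHS]EFinM; apply: lee_wpmul2l.
  by rewrite lee_fin !mulr_ge0 ?normal_peak_ge0 ?ltW.
by apply: (le_trans PA); rewrite subKr.
Qed.

End estimates.

(** * Convergence of integrals *)

Section convergence.
Context {R : realType} {d : measure_display} {Omega : measurableType d}.
Variable P : probability Omega R.

Lemma integral_le_cst (f : Omega -> R) (c : R) : measurable_fun setT f ->
  (forall w, 0 <= f w <= c) ->
  (0 <= \int[P]_w (f w)%:E <= c%:E)%E.
Proof.
move=> mf fc; apply/andP; split.
  by apply: integral_ge0 => w _; rewrite lee_fin; case/andP: (fc w).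
have <- : (\int[P]_w (cst c%:E w) = c%:E)%E.
  by rewrite integral_cst//= probability_setT mule1.
apply: ge0_le_integral => //.
- by move=> w _; rewrite lee_fin; case/andP: (fc w).
- exact/measurable_EFinP.
- by move=> w _; rewrite lee_fin; case/andP: (fc w).
Qed.

(** Truncation at 4^n changes every integral by at most 8c / 2^n, uniformly in k, and truncated
    integrals converge by domination; three errors of e / 3 remain. *)
Lemma uniform_tail_cvg (G_ : nat -> Omega -> R) (G : Omega -> R) (c : R) (n0 : nat) :
  0 <= c -> (forall k w, 0 <= G_ k w) -> (forall w, 0 <= G w) ->
  (forall k, measurable_fun setT (G_ k)) -> measurable_fun setT G ->
  (forall k j, (n0 <= j)%N -> (P [set w | 4 ^+ j < G_ k w]%R <= (c / 8 ^+ j)%:E)%E) ->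
  (forall j, (n0 <= j)%N -> (P [set w | 4 ^+ j < G w]%R <= (c / 8 ^+ j)%:E)%E) ->
  {ae P, forall w, G_ k w @[k --> \oo] --> G w} ->
  (\int[P]_w (G w)%:E)%E \is a fin_num /\
  fine (\int[P]_w (G_ k w)%:E)%E @[k --> \oo] --> fine (\int[P]_w (G w)%:E)%E.
Proof.
move=> c0 G_0 G0 mG_ mG tail_ tail GG.
pose trunc (H : Omega -> R) n w := Num.min (H w) (4 ^+ n).
have mt (H : Omega -> R) n : measurable_fun setT H -> measurable_fun setT (trunc H n).
  by move=> mH; exact: measurable_minr.
have tbound (H : Omega -> R) n w : (forall w, 0 <= H w) -> 0 <= trunc H n w <= 4 ^+ n.
  by move=> H0; rewrite le_min H0 exprn_ge0//= ge_min lexx orbT.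
pose I (H : Omega -> R) n := fine (\int[P]_w (trunc H n w)%:E)%E.
have IE (H : Omega -> R) n : measurable_fun setT H -> (forall w, 0 <= H w) ->
    (\int[P]_w (trunc H n w)%:E)%E = (I H n)%:E.
  move=> mH H0; rewrite fineK//.
  have /andP[h1 h2] := integral_le_cst (mt H n mH) (fun w => tbound H n w H0).
  by rewrite ge0_fin_numE// (le_lt_trans h2) ?ltry.
have bounds (H : Omega -> R) n : measurable_fun setT H -> (forall w, 0 <= H w) -> (n0 <= n)%N ->
    (forall j, (n0 <= j)%N -> (P [set w | 4 ^+ j < H w]%R <= (c / 8 ^+ j)%:E)%E) ->
    [/\ (\int[P]_w (H w)%:E)%E \is a fin_num,
      I H n <= fine (\int[P]_w (H w)%:E)%E &
      fine (\int[P]_w (H w)%:E)%E <= I H n + 8 * c / 2 ^+ n].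
  move=> mH H0 n0n tH.
  have up := @uniform_integrability_tail _ _ _ P H c n H0 c0 mH
    (fun j nj => tH j (leq_trans n0n nj)).
  rewrite -/(trunc H n) IE// -EFinD in up.
  have low : ((I H n)%:E <= \int[P]_w (H w)%:E)%E.
    rewrite -IE//; apply: ge0_le_integral => //.
    - by move=> w _; rewrite lee_fin; case/andP: (tbound H n w H0).
    - by apply/measurable_EFinP; exact: mt.
    - exact/measurable_EFinP.
    - by move=> w _; rewrite lee_fin ge_min lexx.
  have fin : (\int[P]_w (H w)%:E)%E \is a fin_num.
    rewrite ge0_fin_numE ?(le_lt_trans up) ?ltry//.
    by apply: integral_ge0 => w _; rewrite lee_fin.
  by split; [|rewrite -lee_fin (fineK fin)|rewrite -lee_fin (fineK fin)].
have Icvg n : I (G_ k) n @[k --> \oo] --> I G n.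
  have [|||||_ _ H] := @dominated_convergence _ _ _ P setT measurableT
    (fun k w => (trunc (G_ k) n w)%:E) (fun w => (trunc G n w)%:E) (cst (4 ^+ n)%:E).
  - by move=> k; apply/measurable_EFinP; exact: mt.
  - by apply/measurable_EFinP; exact: mt.
  - apply: filterS GG => w Gw _; apply: cvg_EFin; first exact: nearW.
    rewrite /trunc minr_absE; under eq_fun do rewrite minr_absE.
    have Gwc : G_ k w - 4 ^+ n @[k --> \oo] --> G w - 4 ^+ n.
      by apply: cvgB => //; exact: cvg_cst.
    apply: cvgM; last exact: cvg_cst.
    by apply: cvgB; [apply: cvgD => //; exact: cvg_cst|exact: cvg_norm].
  - exact: finite_measure_integrable_cst.
  - apply: aeW => w k _; rewrite lee_fin.
    by have /andP[h1 h2] := tbound (G_ k) n w (G_0 k); rewrite ger0_norm.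
  apply: fine_cvg; rewrite -IE//.
split; first by case: (bounds G n0 mG G0 (leqnn _) tail).
apply/cvgrPdist_lt => e e0.
have [n n0n cn] : exists2 n, (n0 <= n)%N & 8 * c / 2 ^+ n < e / 3.
  have e3 : 0 < e / 3 by lra.
  exists (n0 + (Num.truncn (8 * c / (e / 3))).+1)%N; first exact: leq_addr.
  rewrite ltr_pdivrMr ?exprn_gt0// [ltRHS]mulrC -ltr_pdivrMr//.
  apply: (lt_le_trans (truncnS_gt _)); rewrite -natrX ler_nat.
  by apply: (leq_trans (leq_addl n0 _)); exact/ltnW/ltn_expl.
have e3 : 0 < e / 3 by lra.
have [_ b1 b2] := bounds G n mG G0 n0n tail.
have /cvgrPdist_lt/(_ _ e3) := Icvg n; apply: filterS => k.
have [_ b3 b4] := bounds (G_ k) n (mG_ k) (G_0 k) n0n (tail_ k).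
rewrite !ltr_norml => /andP[k1 k2]; apply/andP; split; lra.
Qed.

End convergence.

(** The plane is first countable, so sequences suffice. The radius restricts them to first
    coordinates near that of the limit, where the tail estimates are uniform. *)
Lemma sequential_within_continuous {R : realType} (A : set (R * R)) (F : R * R -> R) :
  (forall p, A p -> exists2 r, 0 < r & forall q : nat -> R * R,
     (forall k, A (q k)) ->
     (forall k, `|(q k).1 - p.1| < r) ->
     (q k).1 @[k --> \oo] --> p.1 -> (q k).2 @[k --> \oo] --> p.2 ->
     F (q k) @[k --> \oo] --> F p) ->
  {within A, continuous F}.
Proof.
move=> H; apply/subspace_continuousP => p Ap; have [r r0 {}H] := H p Ap.
apply/cvgrPdist_lt => e e0; apply: contrapT => nF.
have /choice[q Hq] : forall k : nat, exists q : R * R,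
    [/\ A q, `|q.1 - p.1| < Num.min r k.+1%:R^-1,
        `|q.2 - p.2| < k.+1%:R^-1 & e <= `|F p - F q|].
  move=> k; apply: contrapT => /forallNP nq; apply: nF.
  have k0 : 0 < k.+1%:R^-1 :> R by rewrite invr_gt0.
  have rk0 : 0 < Num.min r k.+1%:R^-1 by rewrite lt_min r0.
  exists (ball p.1 (Num.min r k.+1%:R^-1), ball p.2 k.+1%:R^-1).
    by split; apply: nbhsx_ballx.
  move=> q [/= q1 q2] Aq; rewrite ltNge; apply/negP => eF; apply: (nq q).
  by split => //; rewrite distrC.
have cvgq (f : R * R -> R) : (forall k, `|f (q k) - f p| < k.+1%:R^-1) ->
    f (q k) @[k --> \oo] --> f p.
  move=> Hf; apply/cvgrPdist_lt => z z0.
  have := near_infty_natSinv_lt (PosNum z0); apply: filterS => k /= kz.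
  by rewrite distrC (lt_trans (Hf k)).
have /cvgrPdist_lt/(_ _ e0)[k _ /(_ k (leqnn k))/=] : F (q k) @[k --> \oo] --> F p.
  apply: H.
  - by move=> k; case: (Hq k).
  - by move=> k; case: (Hq k) => _ + _ _; rewrite lt_min => /andP[].
  - apply: (cvgq fst) => k; case: (Hq k) => _ + _ _.
    by rewrite lt_min => /andP[].
  - by apply: (cvgq snd) => k; case: (Hq k).
by case: (Hq k) => _ _ _; rewrite ltNge => ->.
Qed.

(** * Continuity of the density *)

Section tail.
Context {R : realType} {d : measure_display} {Omega : measurableType d}.
Context {P : probability Omega R}.
Variable Y : nat -> {RV P >-> R}.

Local Notation cdfY y := (cdf (Y 0%N) y).

Lemma cdf_fin_num y : cdfY y \is a fin_num.
Proof. by rewrite ge0_fin_numE// (le_lt_trans (cdf_le1 _ _)) ?ltry. Qed.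

Lemma jump_tail_itv y : 0 <= jump_tail Y y <= 1.
Proof.
rewrite /jump_tail subr_ge0 lerBlDr lerDl -!lee_fin (fineK (cdf_fin_num y)).
by rewrite cdf_le1 cdf_ge0.
Qed.

Lemma measurable_jump_tail : measurable_fun setT (jump_tail Y).
Proof.
apply: nonincreasing_measurable => // y z yz.
by rewrite /jump_tail lerB// fine_le ?cdf_fin_num// cdf_nondecreasing.
Qed.

(** Two values of the distribution function near y differ by at most the mass of a small closed
    ball, and these balls shrink to the atom at y, which has mass 0. *)
Lemma cvg_jump_tail {T : Type} (F : set_system T) {FF : Filter F} (y_ : T -> R) (y : R) :
  ~ 0 < pmf (Y 0%N) y -> y_ n @[n --> F] --> y ->
  jump_tail Y (y_ n) @[n --> F] --> jump_tail Y y.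
Proof.
move=> pmf0 yy; pose Z := Y 0%N.
pose B n := Z @^-1` `[y - n.+1%:R^-1, y + n.+1%:R^-1].
have mB n : measurable (B n) by exact: measurable_preimage.
have mcap : measurable (\bigcap_n B n) by exact: bigcapT_measurable.
have B0 : P (\bigcap_n B n) = 0%E.
  apply/eqP; rewrite -measure_le0 -(fineK (fin_num_measure P _ mcap)) lee_fin.
  rewrite (le_trans _ (_ : pmf Z y <= 0))//; last by rewrite leNgt; apply/negP.
  rewrite /pmf fine_le ?fin_num_measure//.
  apply: le_measure; rewrite ?inE//.
  move=> w Bw /=; apply/eqP; rewrite -subr_eq0 -normr_le0.
  apply/ler_addgt0Pr => e e0; rewrite add0r.
  have [n] := ltr_add_invr e0; rewrite add0r => ne; apply: le_trans (ltW ne).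
  have := Bw n I; rewrite /B /= in_itv /=; set rho := n.+1%:R^-1 => /andP[h1 h2].
  by rewrite ler_norml; apply/andP; split; lra.
have niB : {homo B : n k / (n <= k)%N >-> (k <= n)%O}.
  move=> n k nk; apply/subsetPset => w; rewrite /B /= !in_itv /= => /andP[h1 h2].
  have : k.+1%:R^-1 <= n.+1%:R^-1 :> R by rewrite lef_pV2 ?posrE// ler_nat.
  move=> h; apply/andP; split; first by apply: le_trans h1; rewrite lerB.
  by apply: (le_trans h2); rewrite lerD2l.
have Bcvg : P (B n) @[n --> \oo] --> 0%E.
  rewrite -B0; apply: nonincreasing_cvg_mu => //.
  exact: lt_pinfty_probability.
apply/cvgrPdist_lt => e e0.
have [n Pn] : exists n, (P (B n) < e%:E)%E.
  have /fine_cvgP[_] := Bcvg; move=> /cvgrPdist_lt/(_ _ e0)[n _ /(_ n (leqnn n))] /=.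
  rewrite sub0r normrN ger0_norm ?fine_ge0// => Pn; exists n.
  by rewrite -(fineK (fin_num_measure P _ (mB n))) lte_fin.
have n0 : 0 < n.+1%:R^-1 :> R by rewrite invr_gt0.
have close a b : `|a - y| < n.+1%:R^-1 -> `|b - y| < n.+1%:R^-1 -> a <= b ->
    fine (cdfY b) - fine (cdfY a) < e.
  rewrite !ltr_norml => /andP[a1 a2] /andP[b1 b2] ab.
  rewrite ltrBlDl -lte_fin EFinD !fineK ?cdf_fin_num//.
  apply: (@le_lt_trans _ _ (cdfY a + P (B n))%E); last first.
    by rewrite lteD2lE// cdf_fin_num.
  rewrite /cdf /distribution /pushforward /=.
  apply: (le_trans _ (measureU2 _ _ _)); last 2 first.
  - exact: measurable_preimage.
  - exact: mB.
  apply: le_measure; rewrite ?inE//; first exact: measurable_preimage.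
    by apply: measurableU => //; exact: measurable_preimage.
  move=> w /=; rewrite !in_itv /= => Zb; have [Za|Za] := leP (Z w) a; first by left.
  right; rewrite /B /= in_itv/=; move: a1 b2; set rho := n.+1%:R^-1 => a1 b2.
  by apply/andP; split; lra.
have yc : `|y - y| < n.+1%:R^-1 by rewrite subrr normr0.
have /cvgrPdist_lt/(_ _ n0) := yy; apply: filterS => k; rewrite distrC => yk.
rewrite /jump_tail.
have -> : 1 - fine (cdfY y) - (1 - fine (cdfY (y_ k))) =
  fine (cdfY (y_ k)) - fine (cdfY y) by ring.
have [le_yk|lt_ky] := leP y (y_ k).
  rewrite ger0_norm; first exact: close.
  by rewrite subr_ge0 fine_le ?cdf_fin_num// cdf_nondecreasing.
rewrite distrC ger0_norm; first by apply: close => //; exact: ltW.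
by rewrite subr_ge0 fine_le ?cdf_fin_num// cdf_nondecreasing// ltW.
Qed.

End tail.

(** * Convergence of the two expectations *)

Section density_function.
Context {R : realType} {d : measure_display} {Omega : measurableType d}.
Context {P : probability Omega R}.
Variables (m lambda : R) (W : R -> {RV P >-> R}) (N : R -> {RV P >-> nat}).
Variable (Y : nat -> {RV P >-> R}).
Hypothesis lambda0 : 0 < lambda.
Hypothesis W_bm : brownian_motion W.
Hypothesis N_pp : poisson_process lambda N.
Hypothesis WNY : independent_components W N Y.

Local Notation X t w := (jump_diffusion m W N Y t w).
Local Notation hit x w := (hitting_time m W N Y x w).
Local Notation LJ t w := (last_jump_time N t w).

Definition jump_term (t x : R) (w : Omega) : R :=
  (\1_[set w | (t%:E < hit x w)%E] w : R) * jump_tail Y (x - X t w).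

Definition creeping_term (t x : R) (w : Omega) : R :=
  (\1_[set w | ((LJ t w)%:E < hit x w)%E] w : R) *
  drifted_bm_hitting_density m (t - LJ t w) (x - X (LJ t w) w).

Lemma indic_bool (b : Omega -> bool) (w : Omega) :
  \1_[set w | b w] w = (b w)%:R :> R.
Proof.
rewrite indicE; have -> // : (w \in [set w | b w]) = b w.
by apply/idP/idP; rewrite inE.
Qed.

Lemma measurable_bool_natr (b : Omega -> bool) : measurable_fun setT b ->
  measurable_fun setT (fun w => (b w)%:R : R).
Proof.
move=> mb; have -> : (fun w => (b w)%:R : R) = \1_[set w | b w].
  by apply/funext => w; rewrite indic_bool.
by apply: measurable_indic; exact: measurable_true.
Qed.

Lemma jump_term_itv t x w : 0 <= jump_term t x w <= 1.
Proof.
rewrite /jump_term indic_bool; case: (_ < _)%E; rewrite ?mul1r ?mul0r ?lexx ?ler01//.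
exact: jump_tail_itv.
Qed.

Lemma creeping_term_ge0 t x w : 0 <= creeping_term t x w.
Proof. by rewrite mulr_ge0// density_ge0. Qed.

Lemma measurable_diffusion t : measurable_fun setT (fun w => X t w).
Proof.
apply: measurable_funD.
  exact: measurable_funD.
exact: (measurable_compound (Nf := N t) (Yf := fun i => Y i)).
Qed.

Lemma measurable_grid_max t n (g : Omega -> nat) : measurable_fun setT g ->
  measurable_fun setT (fun w => grid_max m W N Y t 0 n (g w) w).
Proof.
move=> mg.
apply: (measurable_nat_index (F := fun k w => grid_max m W N Y t 0 n k w)) => // k.
apply: measurable_bigmaxr; first exact: measurable_diffusion.
move=> i; case: (_ && _); exact: measurable_diffusion.
Qed.

Lemma measurable_jump_index t n : measurable_fun setT (jump_index N t n).
Proof.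
apply: (@measurable_sum_nat_of_bool _ _ _ _
  (fun (i : 'I_n.+1) w => (N (grid t n i) w < N t w)%N)) => i.
exact: measurable_fun_ltn.
Qed.

Lemma grid_index_of_full (t : R) n : 0 < t -> grid_index_of t t n n.+1.
Proof. by move=> t0; split; rewrite ?grid_full// ltrDl divr_gt0. Qed.

Lemma ae_off_supremum_fixed (t x : R) : 0 < t -> 0 < x ->
  {ae P, forall w, regular_path W N w -> off_supremum m W N Y w t x}.
Proof.
move=> t0 x0.
apply: (@ae_off_supremum _ _ _ P m W N Y W_bm WNY t x (fun=> t) (fun n _ => n.+1) t0 x0).
- by move=> w _; exact: ltW.
- by move=> w n _; exact: grid_index_of_full.
- by move=> e n; exact: measurable_cst.
Qed.

Lemma ae_off_supremum_last_jump (t x : R) : 0 < t -> 0 < x ->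
  {ae P, forall w, regular_path W N w -> off_supremum m W N Y w (LJ t w) x}.
Proof.
move=> t0 x0.
apply: (@ae_off_supremum _ _ _ P m W N Y W_bm WNY t x (fun w => LJ t w)
  (jump_index N t) t0 x0).
- by move=> w w_reg; case: (last_jump_timeP w_reg (ltW t0)).
- by move=> w n w_reg; exact: (jump_indexP w_reg t0).
- by move=> e n; exact: future_measurable_jump_index.
Qed.

(** If t were at most the jump time, [N] would be smaller just before t, against local constancy.
    The strict inequality keeps the density away from its singular time 0. *)
Lemma last_jump_time_lt (t : R) w : 0 < t -> regular_path W N w ->
  locally_constant_at N t w -> LJ t w < t.
Proof.
move=> t0 w_reg [r r0 Hr]; have [T0 Tt NT ltT] := last_jump_timeP w_reg (ltW t0).
rewrite ltNge; apply/negP => tT.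
pose s := Num.max 0 (t - r / 2).
have s0 : 0 <= s by rewrite le_max lexx.
have sr : t - r / 2 <= s by rewrite le_max lexx orbT.
have st : s < t by rewrite gt_max t0; lra.
have : s < LJ t w by exact: lt_le_trans tT.
rewrite ltT// Hr ?ltnn// ltr_norml; apply/andP; split; lra.
Qed.

Lemma null_mod_jump_term t x : 0 < t -> 0 < x ->
  exists Z, null_mod P Z (jump_term t x).
Proof.
move=> t0 x0.
refine (@ae_cvg_null_mod _ _ _ P (fun n w =>
  (grid_max m W N Y t 0 n n.+1 w < x)%R%:R * jump_tail Y (x - X t w)) (jump_term t x) _ _).
  move=> n; apply: measurable_funM.
    apply: measurable_bool_natr; apply: measurable_fun_ltr => //.
    exact: (measurable_grid_max t n (g := fun=> n.+1)).
  apply: measurableT_comp; first exact: measurable_jump_tail.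
  by apply: measurable_funB => //; exact: measurable_diffusion.
near=> w; have w_reg : regular_path W N w by near: w; exact: (ae_regular_path W_bm N_pp).
have off : off_supremum m W N Y w t x.
  by move: (w_reg); near: w; exact: ae_off_supremum_fixed.
rewrite /jump_term indic_bool; apply: cvgM; last exact: cvg_cst.
apply: cvg_near_cst.
have := grid_max_off_supremum w_reg t0 (ltW t0) (fun n => grid_index_of_full n t0) off.
by apply: filterS => n ->.
Unshelve. all: by end_near. Qed.

Lemma null_mod_creeping_term t x : 0 < t -> 0 < x ->
  exists Z, null_mod P Z (creeping_term t x).
Proof.
move=> t0 x0.
refine (@ae_cvg_null_mod _ _ _ P (fun n w =>
  (grid_max m W N Y t 0 n (jump_index N t n w) w < x)%R%:R *
  drifted_bm_hitting_density m (t - grid t n (jump_index N t n w))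
     (x - X (grid t n (jump_index N t n w)) w)) (creeping_term t x) _ _).
  move=> n; apply: measurable_funM.
    apply: measurable_bool_natr; apply: measurable_fun_ltr => //.
    by apply: measurable_grid_max; exact: measurable_jump_index.
  apply: (measurable_nat_index (F := fun k w =>
    drifted_bm_hitting_density m (t - grid t n k) (x - X (grid t n k) w))).
    exact: measurable_jump_index.
  move=> k; apply: measurableT_comp; first exact: measurable_density.
  by apply: measurable_funB => //; exact: measurable_diffusion.
near=> w; have w_reg : regular_path W N w by near: w; exact: (ae_regular_path W_bm N_pp).
have off : off_supremum m W N Y w (LJ t w) x.
  by move: (w_reg); near: w; exact: ae_off_supremum_last_jump.
have lc : locally_constant_at N t w.
  by move: (w_reg); near: w; exact: (ae_locally_constant W lambda0 N_pp t0).
have Tt := last_jump_time_lt t0 w_reg lc.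
have [T0 _ _ _] := last_jump_timeP w_reg (ltW t0).
have gT n := jump_indexP w_reg t0 n.
rewrite /creeping_term indic_bool; apply: cvgM.
  apply: cvg_near_cst.
  have := grid_max_off_supremum w_reg t0 T0 gT off.
  by apply: filterS => n ->.
apply: cvg_density; first by rewrite subr_gt0.
  by apply: cvgB; [exact: cvg_cst|exact: cvg_grid_index].
by apply: cvgB; [exact: cvg_cst|exact: cvg_diffusion_grid_index].
Unshelve. all: by end_near. Qed.

Lemma ae_cvg_jump_term (t x : R) (t_ x_ : nat -> R) : 0 < t -> 0 < x ->
  (forall k, 0 < t_ k) ->
  t_ k @[k --> \oo] --> t -> x_ k @[k --> \oo] --> x ->
  {ae P, forall w, jump_term (t_ k) (x_ k) w @[k --> \oo] --> jump_term t x w}.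
Proof.
move=> t0 x0 t_0 tt xx.
(* The law of Y has countably many atoms, and X_t has none; so x - X_t almost surely avoids them
   all. *)
have noatom : {ae P, forall w, ~ 0 < pmf (Y 0%N) (x - X t w)}.
  have /countable_injP[f f_inj] := pmf_gt0_countable (Y 0%N).
  apply: (@negligibleS _ _ _ _ (\bigcup_k [set w | 0 < pmf (Y 0%N) (x - X t w) /\
     f (x - X t w) = k])).
    by move=> w /= /contrapT H; exists (f (x - X t w)).
  apply: negligible_bigcup => k.
  set Q := [set w | _ /\ _].
  have [[w0 [Q1 Q2]]|nQ] := pselect (exists w, Q w); last first.
    by apply: negligibleS (@negligible_set0 _ _ _ P) => w Qw; apply: nQ; exists w.
  apply: negligibleS (diffusion_no_atom m W_bm WNY (X t w0) t0) => w [q1 q2] /=.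
  have : x - X t w = x - X t w0 by apply: f_inj; rewrite ?inE//; congruence.
  lra.
near=> w; have w_reg : regular_path W N w by near: w; exact: (ae_regular_path W_bm N_pp).
have off : off_supremum m W N Y w t x.
  by move: (w_reg); near: w; exact: ae_off_supremum_fixed.
have lc : locally_constant_at N t w.
  by move: (w_reg); near: w; exact: (ae_locally_constant W lambda0 N_pp t0).
have na : ~ 0 < pmf (Y 0%N) (x - X t w) by near: w.
rewrite /jump_term indic_bool; under eq_fun do rewrite indic_bool.
apply: cvgM.
  apply: cvg_near_cst.
  have := hitting_time_stable w_reg t0 lc off tt xx.
  by apply: filterS => k ->.
apply: cvg_jump_tail => //; apply: cvgB => //.
apply/cvgrPdist_lt => e e0.
have [r r0 Hr] := diffusion_cts m Y w_reg (ltW t0) e0 lc.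
have /cvgrPdist_lt/(_ _ r0) := tt; apply: filterS => k tk.
by rewrite distrC; apply: Hr; [exact: ltW|rewrite distrC].
Unshelve. all: by end_near. Qed.

Lemma ae_cvg_creeping_term (t x : R) (t_ x_ : nat -> R) : 0 < t -> 0 < x ->
  (forall k, 0 < t_ k) ->
  t_ k @[k --> \oo] --> t -> x_ k @[k --> \oo] --> x ->
  {ae P, forall w, creeping_term (t_ k) (x_ k) w @[k --> \oo] --> creeping_term t x w}.
Proof.
move=> t0 x0 t_0 tt xx.
near=> w; have w_reg : regular_path W N w by near: w; exact: (ae_regular_path W_bm N_pp).
have off : off_supremum m W N Y w (LJ t w) x.
  by move: (w_reg); near: w; exact: ae_off_supremum_last_jump.
have lc : locally_constant_at N t w.
  by move: (w_reg); near: w; exact: (ae_locally_constant W lambda0 N_pp t0).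
have Tt := last_jump_time_lt t0 w_reg lc.
have [T0 _ _ _] := last_jump_timeP w_reg (ltW t0).
(* Near t the last jump time is frozen, so only the time argument and the level of the density still
   vary. *)
have Teq : \forall k \near \oo, LJ (t_ k) w = LJ t w.
  case: lc => r r0 Hr; have /cvgrPdist_lt/(_ _ r0) := tt; apply: filterS => k tk.
  by rewrite /last_jump_time Hr//; [exact: ltW|rewrite distrC].
apply: (@cvg_trans _ (((LJ t w)%:E < hit (x_ k) w)%E%:R *
    drifted_bm_hitting_density m (t_ k - LJ t w) (x_ k - X (LJ t w) w) @[k --> \oo])).
  apply: near_eq_cvg; apply: filterS Teq => k Tk.
  by rewrite /creeping_term indic_bool Tk.
rewrite /creeping_term indic_bool; apply: cvgM.
  apply: cvg_near_cst.
  have := hitting_time_stable_level w_reg T0 off xx.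
  by apply: filterS => k ->.
apply: cvg_density; first by rewrite subr_gt0.
  by apply: cvgB => //; exact: cvg_cst.
by apply: cvgB => //; exact: cvg_cst.
Unshelve. all: by end_near. Qed.

(* A value of the density above [4 ^ j] forces both the time since the last jump to
   be O(4 ^ -j) and the position at that jump to be within O(2 ^ -j) of [x]. *)
Lemma creeping_term_tail (t : R) : 0 < t ->
  exists c j0, 0 <= c /\ forall s x j, `|s - t| < t / 2 -> (j0 <= j)%N ->
    exists B, [/\ measurable B,
      [set w | regular_path W N w /\ 4 ^+ j < creeping_term s x w] `<=` B &
      (P B <= (c / 8 ^+ j)%:E)%E].
Proof.
move=> t0.
have [C C0 HC] := density_bound m (2 * t).
pose a := t / 4; have a0 : 0 < a by rewrite /a; lra.
pose K := normal_peak (Num.sqrt a).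
have K0 : 0 <= K by exact: normal_peak_ge0.
(* With r = C / 4^j and h = sqrt C / 2^j the jump estimate 3 K h lambda r is this constant over 8^j.
   The threshold on j ensures r <= a = t / 4, hence a + r <= t / 2 < s. *)
exists (3 * K * Num.sqrt C * (lambda * C)), (Num.truncn (C / a)).+1; split.
  apply: mulr_ge0; last by rewrite mulr_ge0// ltW.
  by apply: mulr_ge0; [exact: mulr_ge0|exact: sqrtr_ge0].
move=> s x j; rewrite ltr_norml => /andP[s1 s2] j0j.
have s0 : 0 < s by lra.
pose r := C / 4 ^+ j; pose h := Num.sqrt C / 2 ^+ j.
have r0 : 0 < r by rewrite divr_gt0// exprn_gt0.
have h0 : 0 < h by rewrite divr_gt0 ?exprn_gt0 ?sqrtr_gt0.
have ra : r <= a.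
  rewrite ler_pdivrMr ?exprn_gt0// mulrC -ler_pdivrMr//.
  apply: (le_trans (ltW (truncnS_gt _))); rewrite -natrX ler_nat.
  by apply: (leq_trans j0j); exact/ltnW/ltn_expl.
have ars : a + r <= s by rewrite /a in ra *; lra.
have [B [mB QB PB]] := last_jump_cover m lambda0 W_bm N_pp WNY x a0 ars r0 h0.
exists B; split => //; last first.
  apply: (le_trans PB); rewrite lee_fin le_eqVlt; apply/orP; left; apply/eqP.
  rewrite -/K /r /h.
  have -> : (8 = 4 * 2 :> R)%R by lra.
  rewrite exprMn; field.
  by rewrite !expf_neq0.
move=> w [w_reg big]; apply: QB => /=.
have p4 : 0 < 4 ^+ j :> R by rewrite exprn_gt0.
have [T0 Ts _ _] := last_jump_timeP w_reg (ltW s0).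
move: big; rewrite /creeping_term indic_bool.
case: (_ < _)%E; rewrite ?mul1r ?mul0r => big; last first.
  by have := lt_trans p4 big; rewrite ltxx.
set u := s - LJ s w in big *; set z := x - X (LJ s w) w in big *.
have u0 : 0 < u.
  move: big; rewrite /drifted_bm_hitting_density; case: ifP => // _ big.
  by have := lt_trans p4 big; rewrite ltxx.
have uM : u <= 2 * t by rewrite /u; lra.
have [H1 H2] := HC u z u0 uM.
split => //.
  rewrite /r ltr_pdivlMr// mulrC; apply: lt_le_trans H1; by rewrite ltr_pM2r.
have z2 : 4 ^+ j * z ^+ 2 < C.
  have [->|z0] := eqVneq z 0; first by rewrite expr0n mulr0.
  by apply: lt_le_trans H2; rewrite ltr_pM2r// exprn_even_gt0.
rewrite /h ltr_pdivlMr ?exprn_gt0//.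
rewrite -(@ltr_pXn2r _ 2) ?nnegrE ?sqrtr_ge0 ?mulr_ge0 ?exprn_ge0//.
rewrite (sqr_sqrtr (ltW C0)) exprMn real_normK ?num_real//.
have -> : (2 ^+ j) ^+ 2 = 4 ^+ j :> R.
  by rewrite -exprM mulnC exprM; congr (_ ^+ j); lra.
rewrite mulrC; apply: z2.
Qed.

(** Each function is cut off on its own null set. There are countably many of these, so almost every
    point avoids them all and pointwise convergence is unaffected. *)
Lemma fine_integral_null_mod_cvg (f_ : nat -> Omega -> R) (f : Omega -> R) (c : R) (j0 : nat) :
  0 <= c -> (forall k w, 0 <= f_ k w) -> (forall w, 0 <= f w) ->
  (forall k, exists Z, null_mod P Z (f_ k)) -> (exists Z, null_mod P Z f) ->
  (forall k j, (j0 <= j)%N -> exists B, [/\ measurable B,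
      [set w | regular_path W N w /\ 4 ^+ j < f_ k w] `<=` B &
      (P B <= (c / 8 ^+ j)%:E)%E]) ->
  (forall j, (j0 <= j)%N -> exists B, [/\ measurable B,
      [set w | regular_path W N w /\ 4 ^+ j < f w] `<=` B &
      (P B <= (c / 8 ^+ j)%:E)%E]) ->
  {ae P, forall w, f_ k w @[k --> \oo] --> f w} ->
  (\int[P]_w (f w)%:E)%E \is a fin_num /\
  fine (\int[P]_w (f_ k w)%:E)%E @[k --> \oo] --> fine (\int[P]_w (f w)%:E)%E.
Proof.
move=> c0 f_0 f0 /choice[Z_ HZ_] [Z HZ] tail_ tail ff.
rewrite (integral_null_mod f0 HZ).
have -> : (fun k => fine (\int[P]_w (f_ k w)%:E)%E) =
    (fun k => fine (\int[P]_w (f_ k w * \1_(~` Z_ k) w)%:E)%E).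
  by apply/funext => k; rewrite (integral_null_mod (f_0 k) (HZ_ k)).
have [Nr [mNr PNr subNr]] := ae_regular_path W_bm N_pp.
have tailE (H : Omega -> R) (V : set Omega) j : null_mod P V H -> (forall w, 0 <= H w) ->
    (exists B, [/\ measurable B,
      [set w | regular_path W N w /\ 4 ^+ j < H w] `<=` B &
      (P B <= (c / 8 ^+ j)%:E)%E]) ->
    (P [set w | 4 ^+ j < H w * \1_(~` V) w]%R <= (c / 8 ^+ j)%:E)%E.
  move=> [mV PV mH] H0 [B [mB HB PB]].
  apply: (@le_trans _ _ (P (Nr `|` B))).
    apply: le_measure; rewrite ?inE//.
    - by apply: measurable_true; exact: measurable_fun_ltr.
    - exact: measurableU.
    - move=> w /= Hw; have [Nw|Nw] := pselect (Nr w); [by left|right].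
      apply: HB; split; first by apply: contrapT => h; apply: Nw; exact: subNr.
      apply: (lt_le_trans Hw); rewrite indicE; case: (_ \in _); first by rewrite mulr1.
      by rewrite mulr0.
  apply: (@le_trans _ _ (P Nr + P B)%E); first exact: measureU2.
  by rewrite PNr add0e.
apply: (@uniform_tail_cvg _ _ _ P (fun k w => f_ k w * \1_(~` (Z_ k)) w)
  (fun w => f w * \1_(~` Z) w) c j0) => //.
- by move=> k w; rewrite mulr_ge0.
- by move=> w; rewrite mulr_ge0.
- by move=> k; case: (HZ_ k).
- by case: HZ.
- by move=> k j jj; apply: tailE => //; exact: tail_.
- by move=> j jj; apply: tailE => //; exact: tail.
have aeZ : {ae P, forall w, ~ Z w}.
  by case: HZ => mZ PZ _; exists Z; split => // w /= /contrapT.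
have aeZ_ : {ae P, forall w, forall k, ~ Z_ k w}.
  apply: ae_foralln => k; case: (HZ_ k) => mZ PZ _; exists (Z_ k); split => // w /=.
  exact: contrapT.
near=> w.
have Zw : ~ Z w by near: w.
have Z_w : forall k, ~ Z_ k w by near: w.
rewrite indicE mem_set// mulr1.
have -> : (fun k => f_ k w * \1_(~` Z_ k) w) = f_ ^~ w.
  by apply/funext => k; rewrite indicE mem_set ?mulr1//; exact: Z_w.
by near: w.
Unshelve. all: by end_near. Qed.

Lemma jump_integral_cvg (t x : R) (t_ x_ : nat -> R) : 0 < t -> 0 < x ->
  (forall k, 0 < t_ k) -> (forall k, 0 < x_ k) ->
  t_ k @[k --> \oo] --> t -> x_ k @[k --> \oo] --> x ->
  ('E_P[jump_term t x])%E \is a fin_num /\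
  fine ('E_P[jump_term (t_ k) (x_ k)])%E @[k --> \oo] --> fine ('E_P[jump_term t x])%E.
Proof.
move=> t0 x0 t_0 x_0 tt xx; rewrite unlock.
(* The first integrand is at most 1 <= 4^j, so its tail events are empty and the constant 0
   works. *)
have tail s y j : exists B, [/\ measurable B,
    [set w | regular_path W N w /\ 4 ^+ j < jump_term s y w] `<=` B &
    (P B <= (0 / 8 ^+ j)%:E)%E].
  exists set0; split => //; last by rewrite measure0 mul0r.
  move=> w [_ /=]; have /andP[_ h1] := jump_term_itv s y w => h2.
  have : 4 ^+ j < 1 :> R by exact: lt_le_trans h1.
  by rewrite ltNge exprn_ege1// ler1n.
apply: (@fine_integral_null_mod_cvg (fun k => jump_term (t_ k) (x_ k))
  (jump_term t x) 0 0) => //.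
- by move=> k w; case/andP: (jump_term_itv (t_ k) (x_ k) w).
- by move=> w; case/andP: (jump_term_itv t x w).
- by move=> k; exact: null_mod_jump_term.
- exact: null_mod_jump_term.
- exact: ae_cvg_jump_term.
Qed.

Lemma creeping_integral_cvg (t x : R) (t_ x_ : nat -> R) : 0 < t -> 0 < x ->
  (forall k, 0 < t_ k) -> (forall k, 0 < x_ k) ->
  (forall k, `|t_ k - t| < t / 2) ->
  t_ k @[k --> \oo] --> t -> x_ k @[k --> \oo] --> x ->
  ('E_P[creeping_term t x])%E \is a fin_num /\
  fine ('E_P[creeping_term (t_ k) (x_ k)])%E @[k --> \oo] --> fine ('E_P[creeping_term t x])%E.
Proof.
move=> t0 x0 t_0 x_0 t_t tt xx; rewrite unlock.
have [c [j0 [c0 tail]]] := creeping_term_tail t0.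
apply: (@fine_integral_null_mod_cvg (fun k => creeping_term (t_ k) (x_ k))
  (creeping_term t x) c j0) => //.
- by move=> k w; exact: creeping_term_ge0.
- by move=> w; exact: creeping_term_ge0.
- by move=> k; exact: null_mod_creeping_term.
- exact: null_mod_creeping_term.
- by move=> k j; exact: tail.
- by move=> j; apply: tail; rewrite subrr normr0 divr_gt0.
- exact: ae_cvg_creeping_term.
Qed.

Lemma hitting_density_cvg (t x : R) (t_ x_ : nat -> R) : 0 < t -> 0 < x ->
  (forall k, 0 < t_ k) -> (forall k, 0 < x_ k) ->
  (forall k, `|t_ k - t| < t / 2) ->
  t_ k @[k --> \oo] --> t -> x_ k @[k --> \oo] --> x ->
  fine (hitting_density m lambda W N Y (t_ k) (x_ k)) @[k --> \oo] -->
  fine (hitting_density m lambda W N Y t x).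
Proof.
move=> t0 x0 t_0 x_0 t_t tt xx.
(* [fine] is additive only on finite values; finiteness comes from the convergence lemmas applied to
   constant sequences. *)
have fin s y : 0 < s -> 0 < y ->
    fine (hitting_density m lambda W N Y s y) =
    lambda * fine ('E_P[jump_term s y])%E + fine ('E_P[creeping_term s y])%E.
  move=> s0 y0.
  have [f1 _] := @jump_integral_cvg s y (fun=> s) (fun=> y) s0 y0 (fun=> s0) (fun=> y0)
    (cvg_cst _) (cvg_cst _).
  have ss k : `|(fun _ : nat => s) k - s| < s / 2 by rewrite subrr normr0 divr_gt0.
  have [f2 _] := @creeping_integral_cvg s y (fun=> s) (fun=> y) s0 y0 (fun=> s0)
    (fun=> y0) ss (cvg_cst _) (cvg_cst _).
  rewrite /hitting_density -/(jump_term s y) -/(creeping_term s y).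
  by rewrite fineD ?fin_numM// fineM.
rewrite fin//; under eq_fun do rewrite fin//.
have [_ c1] := jump_integral_cvg t0 x0 t_0 x_0 tt xx.
have [_ c2] := creeping_integral_cvg t0 x0 t_0 x_0 t_t tt xx.
by apply: cvgD => //; apply: cvgM => //; exact: cvg_cst.
Qed.

Lemma hitting_density_fin_num (t x : R) : 0 < t -> 0 < x ->
  hitting_density m lambda W N Y t x \is a fin_num.
Proof.
move=> t0 x0.
have [f1 _] := @jump_integral_cvg t x (fun=> t) (fun=> x) t0 x0 (fun=> t0) (fun=> x0)
  (cvg_cst _) (cvg_cst _).
have tt k : `|(fun _ : nat => t) k - t| < t / 2 by rewrite subrr normr0 divr_gt0.
have [f2 _] := @creeping_integral_cvg t x (fun=> t) (fun=> x) t0 x0 (fun=> t0)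
  (fun=> x0) tt (cvg_cst _) (cvg_cst _).
by rewrite fin_numD fin_numM.
Qed.

End density_function.

Unset Implicit Arguments.

Theorem proposition1 (R : realType) (d : measure_display)
    (Omega : measurableType d) (P : probability Omega R)
    (m lambda : R) (W : R -> {RV P >-> R}) (N : R -> {RV P >-> nat})
    (Y : nat -> {RV P >-> R}) :
  0 < lambda ->
  brownian_motion W ->
  poisson_process lambda N ->
  iid Y ->
  independent_components W N Y ->
  (forall t x : R, 0 < t -> 0 < x ->
     hitting_density m lambda W N Y t x \is a fin_num) /\
  {within [set p : R * R | 0 < p.1 /\ 0 < p.2],
    continuous (fun p : R * R =>
      fine (hitting_density m lambda W N Y p.1 p.2))}.
Proof.
move=> lambda0 W_bm N_pp _ WNY; split.
  by move=> t x; exact: hitting_density_fin_num.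
apply: sequential_within_continuous => -[t x] /= [t0 x0].
(* This is the neighborhood of t on which the tail bound of the second integrand is uniform. *)
exists (t / 2) => [|q q0 qt q1 q2]; first by rewrite divr_gt0.
apply: (hitting_density_cvg lambda0 W_bm N_pp WNY t0 x0 _ _ qt q1 q2).
  by move=> k; case: (q0 k).
by move=> k; case: (q0 k).
Qed.
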